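(* Let $$L(z)=L_{gl_n[t]}(z)=\sum_{i=1}^{\infty}\frac{1}{z^{i}}\begin{pmatrix} e_{1,1}t^{i-1}&\dots&e_{1,n}t^{i-1}\\ \vdots&&\vdots\\ e_{n,1}t^{i-1}&\dots&e_{n,n}t^{i-1}\end{pmatrix}\in \mathrm{Mat}_n\otimes U(gl_n[t])\otimes\mathbb C((z^{-1})),$$ and let $L^{[k]}(z)$ be its quantum powers, defined by $L^{[0]}(z)=\mathrm{Id}$, $L^{[k]}(z)=L^{[k-1]}(z)L(z)+\partial_z\bigl(L^{[k-1]}(z)\bigr)$ (the last term being the $z$-derivative of $L^{[k-1]}(z)$). Then the series $\mathrm{Tr}\,L^{[k]}(z)$ are generating functions (in the variable $z$) of elements of the commutative Bethe subalgebra of $U(gl_n[t])$. Such elements for $k=1,\dots,n$ algebraically generate the Bethe subalgebra.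
   Context: $e_{ij}$ is the standard basis of $gl_n$, $gl_n[t]$ the polynomial current Lie algebra over $\mathbb C$, $U(\cdot)$ the universal enveloping algebra. The Bethe subalgebra of $U(gl_n[t])$ is the commutative subalgebra generated by all coefficients (in $z$) of the series $QH_i(z)$, $i=0,\dots,n$, defined by $\det^{col}(\partial_z-L_{gl_n[t]}(z))=\sum_{i=0}^n QH_i(z)\partial_z^i$, where $[\partial_z,f(z)]=f'(z)$ and $\det^{col}N=\sum_{\sigma\in S_n}(-1)^\sigma N_{\sigma(1),1}\cdots N_{\sigma(n),n}$. *)

(* Defs.v *)
From HB Require Import structures.
From mathcomp Require Import all_boot all_order all_algebra perm.
From mathcomp Require Import finmap monalg complex generic_quotient zify ring.
From mathcomp Require Import boolp classical_sets functions cardinality fsbigop.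
From mathcomp Require Import reals.

Set Implicit Arguments.
Unset Strict Implicit.
Unset Printing Implicit Defensive.

Import Order.TTheory GRing.Theory Num.Theory.

Local Open Scope ring_scope.

HB.mixin Record Lmodule_isLie (K : fieldType) (g : Type) of GRing.Lmodule K g := {
  lie : g -> g -> g;
  lie_linearl : forall y, linear (lie^~ y);
  lie_linearr : forall x, linear (lie x);
  liexx : forall x, lie x x = 0;
  lie_jacobi : forall x y z,
    lie x (lie y z) + lie y (lie z x) + lie z (lie x y) = 0
}.

#[short(type="lieAlgType")]
HB.structure Definition LieAlgebra (K : fieldType) :=
  {g of GRing.Lmodule K g & Lmodule_isLie K g}.

Section Enveloping.
Variables (K : fieldType) (g : lieAlgType K).

(* The free associative unital algebra on the underlying set of g; the linear
   structure of g is recovered by the relation [uea_lin] below, so that the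
   quotient is T(g) / (x (x) y - y (x) x - [x, y]). *)
Local Notation free_alg := {malg K[{fmonom g}]}.

Definition free_gen (x : g) : free_alg := << fmu x >>.

Inductive uea_ideal : free_alg -> Prop :=
| uea_lin a x y :
    uea_ideal (free_gen (a *: x + y) - (a *: free_gen x + free_gen y))
| uea_lie x y :
    uea_ideal (free_gen x * free_gen y - free_gen y * free_gen x
               - free_gen (lie x y))
| uea_ideal0 : uea_ideal 0
| uea_idealB u v : uea_ideal u -> uea_ideal v -> uea_ideal (u - v)
| uea_idealMl w u : uea_ideal u -> uea_ideal (w * u)
| uea_idealMr w u : uea_ideal u -> uea_ideal (u * w).

Lemma uea_idealN u : uea_ideal u -> uea_ideal (- u).
Proof. by move=> ?; rewrite -sub0r; apply/uea_idealB => //; exact: uea_ideal0. Qed.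

Lemma uea_idealD u v : uea_ideal u -> uea_ideal v -> uea_ideal (u + v).
Proof. by move=> ? ?; rewrite -[v]opprK; apply/uea_idealB/uea_idealN. Qed.

Lemma free_scaleE a (u : free_alg) : a *: u = (a *: 1) * u.
Proof. by rewrite -scalerAl mul1r. Qed.

Lemma uea_idealZ a u : uea_ideal u -> uea_ideal (a *: u).
Proof. by rewrite free_scaleE; exact: uea_idealMl. Qed.

Definition uea_equiv : rel free_alg := fun u v => `[< uea_ideal (u - v) >].

Lemma uea_equiv_class : equiv_class_of uea_equiv.
Proof.
split=> [u|u v|v u w]; first by apply/asboolP; rewrite subrr; exact: uea_ideal0.
  by apply/asboolP/asboolP => /uea_idealN; rewrite opprB.
move=> /asboolP uv /asboolP vw; apply/asboolP.
by rewrite -(subrKA v); exact: uea_idealD.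
Qed.

Canonical uea_equiv_rel := EquivRelPack uea_equiv_class.
Definition UEA : Type := {eq_quot uea_equiv}%qT.
HB.instance Definition _ : EqQuotient free_alg uea_equiv UEA := EqQuotient.on UEA.
HB.instance Definition _ := Choice.on UEA.

Definition uea_pi (u : free_alg) : UEA := (\pi_UEA u)%qT.

Lemma uea_piP u v : uea_pi u = uea_pi v <-> uea_ideal (u - v).
Proof. by split=> [/eqmodP/asboolP|?]//; apply/eqmodP/asboolP. Qed.

Lemma uea_piK (x : UEA) : uea_pi (repr x)%qT = x.
Proof. exact: reprK. Qed.

Lemma uea_reprK u : uea_ideal (repr (uea_pi u) - u)%qT.
Proof. by apply/uea_piP; rewrite uea_piK. Qed.

Definition uea_add (x y : UEA) : UEA := uea_pi (repr x + repr y)%qT.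
Definition uea_opp (x : UEA) : UEA := uea_pi (- repr x)%qT.
Definition uea_mul (x y : UEA) : UEA := uea_pi (repr x * repr y)%qT.
Definition uea_scale a (x : UEA) : UEA := uea_pi (a *: repr x)%qT.

Lemma uea_piD u v : uea_pi (u + v) = uea_add (uea_pi u) (uea_pi v).
Proof.
apply/esym/uea_piP; rewrite opprD addrACA; apply: uea_idealD; exact: uea_reprK.
Qed.

Lemma uea_piN u : uea_pi (- u) = uea_opp (uea_pi u).
Proof. by apply/esym/uea_piP; rewrite -opprD; apply/uea_idealN/uea_reprK. Qed.

Lemma uea_piM u v : uea_pi (u * v) = uea_mul (uea_pi u) (uea_pi v).
Proof.
apply/esym/uea_piP; set u' := (repr _)%qT; set v' := (repr _)%qT.
have -> : u' * v' - u * v = (u' - u) * v' + u * (v' - v).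
  by rewrite mulrBl mulrBr addrA subrK.
by apply: uea_idealD; [apply: uea_idealMr|apply: uea_idealMl]; exact: uea_reprK.
Qed.

Lemma uea_piZ a u : uea_pi (a *: u) = uea_scale a (uea_pi u).
Proof. by apply/esym/uea_piP; rewrite -scalerBr; apply/uea_idealZ/uea_reprK. Qed.

Lemma uea_addA : associative uea_add.
Proof.
by move=> x y z; rewrite -[x]uea_piK -[y]uea_piK -[z]uea_piK -!uea_piD addrA.
Qed.

Lemma uea_addC : commutative uea_add.
Proof. by move=> x y; rewrite -[x]uea_piK -[y]uea_piK -!uea_piD addrC. Qed.

Lemma uea_add0 : left_id (uea_pi 0) uea_add.
Proof. by move=> x; rewrite -[x]uea_piK -uea_piD add0r. Qed.

Lemma uea_addN : left_inverse (uea_pi 0) uea_opp uea_add.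
Proof. by move=> x; rewrite -[x]uea_piK -uea_piN -uea_piD addNr. Qed.

HB.instance Definition _ :=
  GRing.isZmodule.Build UEA uea_addA uea_addC uea_add0 uea_addN.

Lemma uea_mulA : associative uea_mul.
Proof.
by move=> x y z; rewrite -[x]uea_piK -[y]uea_piK -[z]uea_piK -!uea_piM mulrA.
Qed.

Lemma uea_mul1 : left_id (uea_pi 1) uea_mul.
Proof. by move=> x; rewrite -[x]uea_piK -uea_piM mul1r. Qed.

Lemma uea_mulr1 : right_id (uea_pi 1) uea_mul.
Proof. by move=> x; rewrite -[x]uea_piK -uea_piM mulr1. Qed.

Lemma uea_mulDl : left_distributive uea_mul +%R.
Proof.
move=> x y z; rewrite -[x]uea_piK -[y]uea_piK -[z]uea_piK.
by rewrite -[_ + _]uea_piD -!uea_piM -[RHS]uea_piD mulrDl.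
Qed.

Lemma uea_mulDr : right_distributive uea_mul +%R.
Proof.
move=> x y z; rewrite -[x]uea_piK -[y]uea_piK -[z]uea_piK.
by rewrite -[_ + _]uea_piD -!uea_piM -[RHS]uea_piD mulrDr.
Qed.

Lemma free_gen_coef1 x : (free_gen x)@_mone = 0.
Proof.
rewrite mcoeffU; case: eqP => // /(congr1 (@fmonom_val _)).
by rewrite fmuE fm1.
Qed.

Lemma uea_ideal_coef1 u : uea_ideal u -> u@_mone = 0.
Proof.
elim=> {u} [a x y|x y||u v _ u0 _ v0|w u _ u0|w u _ u0].
- by rewrite mcoeffB mcoeffD mcoeffZ !free_gen_coef1 mulr0 addr0 subr0.
- by rewrite !mcoeffB !rmorphM /= !free_gen_coef1 mulr0 !subr0.
- by rewrite mcoeff0.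
- by rewrite mcoeffB u0 v0 subr0.
- by rewrite rmorphM /= u0 mulr0.
- by rewrite rmorphM /= u0 mul0r.
Qed.

Lemma uea_oner_neq0 : uea_pi 1 != 0.
Proof.
apply/eqP => /uea_piP /uea_ideal_coef1; rewrite subr0 rmorph1 => /eqP.
by rewrite oner_eq0.
Qed.

HB.instance Definition _ := GRing.Zmodule_isNzRing.Build UEA
  uea_mulA uea_mul1 uea_mulr1 uea_mulDl uea_mulDr uea_oner_neq0.

Lemma uea_scaleA a b x : uea_scale a (uea_scale b x) = uea_scale (a * b) x.
Proof. by rewrite -[x]uea_piK -!uea_piZ scalerA. Qed.

Lemma uea_scale1 : left_id 1 uea_scale.
Proof. by move=> x; rewrite -[x]uea_piK -uea_piZ scale1r. Qed.

Lemma uea_scaleDr : right_distributive uea_scale +%R.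
Proof.
move=> a x y; rewrite -[x]uea_piK -[y]uea_piK.
by rewrite -[_ + _]uea_piD -!uea_piZ -[RHS]uea_piD scalerDr.
Qed.

Lemma uea_scaleDl x : {morph uea_scale^~ x : a b / a + b}.
Proof.
by move=> a b; rewrite -[x]uea_piK -!uea_piZ -[RHS]uea_piD scalerDl.
Qed.

HB.instance Definition _ := GRing.Zmodule_isLmodule.Build K UEA
  uea_scaleA uea_scale1 uea_scaleDr uea_scaleDl.

Lemma uea_scaleAl a (x y : UEA) : a *: (x * y) = (a *: x) * y.
Proof.
rewrite -[x]uea_piK -[y]uea_piK -[_ * _]uea_piM.
rewrite -[a *: uea_pi (repr x)%qT]uea_piZ.
by rewrite -[LHS]uea_piZ -[RHS]uea_piM scalerAl.
Qed.

HB.instance Definition _ := GRing.Lmodule_isLalgebra.Build K UEA uea_scaleAl.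

Lemma free_scaleAr a (u v : free_alg) : a *: (u * v) = u * (a *: v).
Proof.
rewrite -!(mul_malgC a) !mulrA; congr (_ * v).
rewrite [_%:MP * u]fgmulUg [u * _%:MP]fgmulgU; apply: eq_bigr => k _.
by rewrite mul1m mulm1 mulrC.
Qed.

Lemma uea_scaleAr a (x y : UEA) : a *: (x * y) = x * (a *: y).
Proof.
rewrite -[x]uea_piK -[y]uea_piK -[_ * _]uea_piM.
rewrite -[a *: uea_pi (repr y)%qT]uea_piZ.
by rewrite -[LHS]uea_piZ -[RHS]uea_piM free_scaleAr.
Qed.

HB.instance Definition _ := GRing.Lalgebra_isAlgebra.Build K UEA uea_scaleAr.

Definition uea_inj (x : g) : UEA := uea_pi (free_gen x).

Lemma uea_inj_linear : linear uea_inj.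
Proof.
move=> a x y; rewrite -[a *: uea_inj x]uea_piZ -[RHS]uea_piD.
exact/uea_piP/uea_lin.
Qed.

HB.instance Definition _ := GRing.isLinear.Build K g UEA *:%R uea_inj
  uea_inj_linear.

Lemma uea_inj_lie x y :
  uea_inj (lie x y) = uea_inj x * uea_inj y - uea_inj y * uea_inj x.
Proof.
rewrite -[uea_inj x * _]uea_piM -[uea_inj y * _]uea_piM -[- _]uea_piN.
by rewrite -[RHS]uea_piD; apply/esym/uea_piP/uea_lie.
Qed.

End Enveloping.

Section Current.
Variables (K : fieldType) (n : nat).

(* gl_n[t] = gl_n (x) K[t], realised as n x n matrices with entries in K[t]:
   the element x t^k is 'X^k *: x. *)
Definition gl_current : Type := 'M[{poly K}]_n.
HB.instance Definition _ := GRing.Zmodule.on gl_current.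

Definition gl_scale (a : K) (x : gl_current) : gl_current := a%:P *: x.

Fact gl_scaleA a b x : gl_scale a (gl_scale b x) = gl_scale (a * b) x.
Proof. by rewrite /gl_scale scalerA polyCM. Qed.

Fact gl_scale1 : left_id 1 gl_scale.
Proof. by move=> x; rewrite /gl_scale scale1r. Qed.

Fact gl_scaleDr : right_distributive gl_scale +%R.
Proof. by move=> a x y; rewrite /gl_scale scalerDr. Qed.

Fact gl_scaleDl x : {morph gl_scale^~ x : a b / a + b}.
Proof. by move=> a b; rewrite /gl_scale polyCD scalerDl. Qed.

HB.instance Definition _ := GRing.Zmodule_isLmodule.Build K gl_current
  gl_scaleA gl_scale1 gl_scaleDr gl_scaleDl.

Definition gl_lie (x y : gl_current) : gl_current := x *m y - y *m x.

Fact gl_lie_linearl y : linear (gl_lie^~ y).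
Proof.
move=> a x z; rewrite /gl_lie -[a *: x]/(a%:P *: (x : 'M__)).
rewrite mulmxDl mulmxDr -scalemxAl -scalemxAr.
rewrite -[a *: (_ - _)]/(a%:P *: (x *m y - y *m x)) scalerBr.
by rewrite opprD addrACA.
Qed.

Fact gl_lie_linearr x : linear (gl_lie x).
Proof.
move=> a y z; have N u v : gl_lie u v = - gl_lie v u by rewrite /gl_lie opprB.
by rewrite N gl_lie_linearl opprD -scalerN -!N.
Qed.

Fact gl_liexx x : gl_lie x x = 0.
Proof. exact: subrr. Qed.

Fact gl_jacobi x y z :
  gl_lie x (gl_lie y z) + gl_lie y (gl_lie z x) + gl_lie z (gl_lie x y) = 0.
Proof.
rewrite /gl_lie !mulmxBl !mulmxBr !mulmxA.
set a := x *m y *m z; set b := x *m z *m y; set c := y *m z *m x.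
set d := z *m y *m x; set e := y *m x *m z; set f := z *m x *m y.
move: (a : 'M__) (b : 'M__) (c : 'M__) (d : 'M__) (e : 'M__) (f : 'M__).
by move=> {}a {}b {}c {}d {}e {}f; apply/matrixP => i j; rewrite !mxE; ring.
Qed.

HB.instance Definition _ := Lmodule_isLie.Build K gl_current
  gl_lie_linearl gl_lie_linearr gl_liexx gl_jacobi.

Definition gl_elt (i j : 'I_n) (k : nat) : gl_current :=
  'X^k *: delta_mx i j.

End Current.

Section FiniteSums.
Variable A : zmodType.
Implicit Types (F G : int -> A) (W : nat).

Local Notation fsum F := (\sum_(i \in [set: int]) F i).

Definition int_box (W : nat) : {fset int} := [fset i%:Z - W%:Z | i in iota 0 W.*2.+1]%fset.

Fact in_box W i : (i \in int_box W) = (`|i|%N <= W)%N.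
Proof.
apply/imfsetP/idP => [[j /=]|iW].
  by rewrite inE mem_iota => jW ->; lia.
by exists (absz (i + W%:Z)%R); rewrite /= ?inE ?mem_iota; lia.
Qed.

Definition supp_in W F := forall i : int, (W < `|i|)%N -> F i = 0.

Fact supp_inW V W F : (V <= W)%N -> supp_in V F -> supp_in W F.
Proof. by move=> VW FV i Wi; apply: FV; lia. Qed.

Fact fsum_box W F : supp_in W F -> fsum F = \sum_(i <- int_box W) F i.
Proof. by move=> FW; apply: fsbigTE => i; rewrite in_box -ltnNge => /FW. Qed.

Fact fsumD W F G : supp_in W F -> supp_in W G ->
  fsum (fun i => F i + G i) = fsum F + fsum G.
Proof.
move=> FW GW; rewrite !(@fsum_box W)// ?big_split//.
by move=> i Wi; rewrite FW// GW// addr0.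
Qed.

Fact fsum_exchange W (F : int -> int -> A) :
    (forall i j, (W < `|i|)%N || (W < `|j|)%N -> F i j = 0) ->
  fsum (fun i => fsum (F i)) = fsum (fun j => fsum (F^~ j)).
Proof.
move=> FW; have h1 i : supp_in W (F i).
  by move=> j Wj; apply: FW; rewrite Wj orbT.
have h2 j : supp_in W (F^~ j) by move=> i Wi; apply: FW; rewrite Wi.
rewrite !(@fsum_box W); last first.
- by move=> i Wi; rewrite fsbig1// => j _; apply: FW; rewrite Wi.
- by move=> j Wj; rewrite fsbig1// => i _; apply: FW; rewrite Wj orbT.
under eq_bigr do rewrite (fsum_box (h1 _)).
under [RHS]eq_bigr do rewrite (fsum_box (h2 _)).
exact: exchange_big.
Qed.

Fact fsum_shift (m : int) F : fsum F = fsum (fun i => F (i + m)).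
Proof.
apply: reindex_fsbigT; exists (fun i => i - m) => i /=; lia.
Qed.

Fact fsum_rev (m : int) F : fsum F = fsum (fun i => F (m - i)).
Proof.
apply: reindex_fsbigT; exists (fun i => m - i) => i /=; lia.
Qed.

Fact fsum_delta k F : (forall i, i != k -> F i = 0) -> fsum F = F k.
Proof.
move=> Fk; rewrite (fsum_box (W := `|k|)); last by move=> i ik; apply: Fk; lia.
rewrite (big_fsetD1 k) ?in_box//= big_seq big1 ?addr0// => i.
by rewrite in_fsetD1 => /andP[/Fk].
Qed.

Fact fsum_morph (h : A -> A) W F : {morph h : x y / x + y} -> h 0 = 0 ->
  supp_in W F -> h (fsum F) = fsum (fun i => h (F i)).
Proof.
move=> hD h0 FW; rewrite (fsum_box FW) (big_morph h hD h0) -fsum_box//.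
by move=> i /FW ->.
Qed.

End FiniteSums.

Section Laurent.
Variable A : nzRingType.

(* A((z^-1)): [lcoef f m] is the coefficient of z^m, and only finitely many
   positive powers of z occur. *)
Record laurent : Type := Laurent {
  lcoef :> int -> A;
  lcoefP : exists N : nat, forall m : int, N%:Z < m -> lcoef m = 0
}.

HB.instance Definition _ := gen_eqMixin laurent.
HB.instance Definition _ := gen_choiceMixin laurent.

Lemma laurentP (f g : laurent) : (forall m, f m = g m) -> f = g.
Proof.
case: f g => [f fP] [g gP] /= /funext fg; subst g.
by congr Laurent; exact: Prop_irrelevance.
Qed.

Implicit Types f g h : laurent.

Fact laurent0_subproof :
  exists N : nat, forall m : int, N%:Z < m -> 0 = 0 :> A.
Proof. by exists 0%N. Qed.
Definition laurent0 := Laurent laurent0_subproof.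

Fact laurentN_subproof f :
  exists N : nat, forall m : int, N%:Z < m -> - f m = 0.
Proof. by have [N fN] := lcoefP f; exists N => m /fN ->; rewrite oppr0. Qed.
Definition laurentN f := Laurent (laurentN_subproof f).

Fact laurentD_subproof f g :
  exists N : nat, forall m : int, N%:Z < m -> f m + g m = 0.
Proof.
have [[N fN] [M gM]] := (lcoefP f, lcoefP g).
by exists (N + M)%N => m Nm; rewrite fN ?gM ?addr0//; lia.
Qed.
Definition laurentD f g := Laurent (laurentD_subproof f g).

Fact laurentD_assoc : associative laurentD.
Proof. by move=> f g h; apply/laurentP => m /=; rewrite addrA. Qed.
Fact laurentD_comm : commutative laurentD.
Proof. by move=> f g; apply/laurentP => m /=; rewrite addrC. Qed.
Fact laurent_add0 : left_id laurent0 laurentD.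
Proof. by move=> f; apply/laurentP => m /=; rewrite add0r. Qed.
Fact laurent_addN : left_inverse laurent0 laurentN laurentD.
Proof. by move=> f; apply/laurentP => m /=; rewrite addNr. Qed.
HB.instance Definition _ := GRing.isZmodule.Build laurent
  laurentD_assoc laurentD_comm laurent_add0 laurent_addN.

Fact lmonom_subproof (a : A) (k : int) :
  exists N : nat, forall m : int, N%:Z < m -> (if m == k then a else 0) = 0.
Proof. by exists `|k|%N => m km; case: eqP => //; lia. Qed.
Definition lmonom a k := Laurent (lmonom_subproof a k).

Fact lmul_supp f g m : exists V : nat, forall W, (V <= W)%N ->
  supp_in W (fun i => f i * g (m - i)).
Proof.
have [[N fN] [M gM]] := (lcoefP f, lcoefP g).
exists (N + M + `|m|)%N => W VW i Wi.
have [Ni|iN] := ltrP N%:Z i; first by rewrite fN ?mul0r.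
by rewrite gM ?mulr0//; lia.
Qed.

Fact laurentM_subproof f g : exists N : nat, forall m : int, N%:Z < m ->
  \sum_(i \in [set: int]) f i * g (m - i) = 0.
Proof.
have [[N fN] [M gM]] := (lcoefP f, lcoefP g).
exists (N + M)%N => m Wm; apply: fsbig1 => i _.
have [Ni|iN] := ltrP N%:Z i; first by rewrite fN ?mul0r.
by rewrite gM ?mulr0//; lia.
Qed.
Definition laurentM f g := Laurent (laurentM_subproof f g).

Fact laurentM_assoc : associative laurentM.
Proof.
move=> f g h; apply/laurentP => m /=.
have [[[N fN] [M gM]] [P hP]] := (lcoefP f, lcoefP g, lcoefP h).
transitivity (\sum_(i \in [set: int]) \sum_(j \in [set: int])
    f i * g (j - i) * h (m - j)).
  apply: eq_fsbigr => i _; have [V gV] := lmul_supp g h (m - i).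
  rewrite (fsum_morph (mulrDr (f i)) (mulr0 _) (gV V (leqnn V))).
  rewrite (fsum_shift (- i)).
  by apply: eq_fsbigr => j _; rewrite mulrA; congr (_ * _ * h _); lia.
rewrite (fsum_exchange (W := (N + M + P + `|m|)%N)).
  apply: eq_fsbigr => j _; have [V fV] := lmul_supp f g j.
  have hD : {morph *%R^~ (h (m - j)) : x y / x + y} by move=> x y; exact: mulrDl.
  by rewrite [RHS](fsum_morph hD (mul0r _) (fV V (leqnn V))).
move=> i j Wij; have [Ni|iN] := ltrP N%:Z i; first by rewrite fN ?mul0r.
have [Mi|iM] := ltrP M%:Z (j - i); first by rewrite gM// mulr0 mul0r.
by rewrite hP ?mulr0//; lia.
Qed.

Fact laurent_mul1 : left_id (lmonom 1 0) laurentM.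
Proof.
move=> f; apply/laurentP => m /=; rewrite (fsum_delta (k := 0)).
  by rewrite eqxx mul1r subr0.
by move=> i /negPf ->; rewrite mul0r.
Qed.

Fact laurent_mulr1 : right_id (lmonom 1 0) laurentM.
Proof.
move=> f; apply/laurentP => m /=; rewrite (fsum_delta (k := m)).
  by rewrite subrr eqxx mulr1.
by move=> i im; rewrite subr_eq0 eq_sym (negPf im) mulr0.
Qed.

Fact laurent_mulDl : left_distributive laurentM +%R.
Proof.
move=> f g h; apply/laurentP => m /=.
have [[V fV] [W gW]] := (lmul_supp f h m, lmul_supp g h m).
rewrite -(fsumD (fV _ (leq_addr W V)) (gW _ (leq_addl V W))).
by apply: eq_fsbigr => i _; rewrite mulrDl.
Qed.

Fact laurent_mulDr : right_distributive laurentM +%R.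
Proof.
move=> f g h; apply/laurentP => m /=.
have [[V fV] [W gW]] := (lmul_supp f g m, lmul_supp f h m).
rewrite -(fsumD (fV _ (leq_addr W V)) (gW _ (leq_addl V W))).
by apply: eq_fsbigr => i _; rewrite mulrDr.
Qed.

Fact laurent_oner_neq0 : lmonom 1 0 != 0.
Proof.
by apply/eqP => /(congr1 (fun f : laurent => f 0))/eqP; rewrite /= oner_eq0.
Qed.

HB.instance Definition _ := GRing.Zmodule_isNzRing.Build laurent
  laurentM_assoc laurent_mul1 laurent_mulr1 laurent_mulDl laurent_mulDr
  laurent_oner_neq0.

Lemma lcoefM f g m : (f * g) m = \sum_(i \in [set: int]) f i * g (m - i).
Proof. by []. Qed.

Lemma lcoefD f g m : (f + g) m = f m + g m.
Proof. by []. Qed.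

Fact lderiv_subproof f : exists N : nat, forall m : int, N%:Z < m ->
  f (m + 1) *~ (m + 1) = 0.
Proof.
by have [N fN] := lcoefP f; exists N => m Nm; rewrite fN ?mul0rz//; lia.
Qed.
Definition lderiv f := Laurent (lderiv_subproof f).

Fact lderiv_is_additive : zmod_morphism lderiv.
Proof. by move=> f g; apply/laurentP => m /=; rewrite mulrzBl. Qed.
HB.instance Definition _ := GRing.isZmodMorphism.Build laurent laurent lderiv
  lderiv_is_additive.

Lemma lderivM f g : lderiv (f * g) = lderiv f * g + f * lderiv g.
Proof.
apply/laurentP => m /=; have [V /(_ V (leqnn V)) fgV] := lmul_supp f g (m + 1).
have df i : f (i - 1 + 1) *~ (i - 1 + 1) * g (m - (i - 1))
    = f i * g (m + 1 - i) *~ i.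
  by rewrite mulrzAl subrK; congr (_ * g _ *~ _); lia.
have dg i : f i * (g (m - i + 1) *~ (m - i + 1))
    = f i * g (m + 1 - i) *~ (m + 1 - i).
  by rewrite mulrzAr (_ : m - i + 1 = m + 1 - i)//; lia.
rewrite [X in _ = X + _](fsum_shift (- 1)).
rewrite -(fsumD (W := V)); last 2 first.
- by move=> i iV; rewrite df fgV// mul0rz.
- by move=> i iV; rewrite dg fgV// mul0rz.
rewrite [LHS](fsum_morph (mulrzDl (m + 1)) (mul0rz _ _) fgV).
apply: eq_fsbigr => i _.
by rewrite df dg -mulrzDr; congr (_ *~ _); lia.
Qed.

End Laurent.

Section DiffOp.
Variable A : nzRingType.
Local Notation S := (laurent A).

(* The operator sum_i f_i (d/dz)^i is represented by the polynomial with
   coefficients f_i (on the left), but with the product given by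
   (d/dz) f = f (d/dz) + f'. *)
Definition diffop : Type := {poly S}.
HB.instance Definition _ := GRing.Lmodule.on diffop.

Implicit Types (P Q T : diffop) (f : S).

Definition dop_coef P (i : nat) : S := (P : {poly S})`_i.

(* left multiplication by d/dz: (d/dz) f_i (d/dz)^i = f_i (d/dz)^(i+1) + f_i' (d/dz)^i *)
Definition dz_mul P : diffop := (P : {poly S}) * 'X + map_poly (@lderiv A) P.

Definition dop_mul P Q : diffop :=
  \sum_(i < size (P : {poly S})) dop_coef P i *: iter i dz_mul Q.

Definition dz : diffop := 'X.
Definition dop_series f : diffop := f%:P.

Fact dop_mulw N P Q : (size (P : {poly S}) <= N)%N ->
  dop_mul P Q = \sum_(i < N) dop_coef P i *: iter i dz_mul Q.
Proof.
move=> PN; rewrite /dop_mul.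
rewrite (big_ord_widen N (fun i => dop_coef P i *: iter i dz_mul Q) PN).
rewrite big_mkcond /=.
apply: eq_bigr => i _; case: ifPn => //; rewrite -leqNgt => Pi.
by rewrite /dop_coef nth_default// scale0r.
Qed.

Fact dop_mulDl : left_distributive dop_mul +%R.
Proof.
move=> P T Q.
pose N := maxn (size (P : {poly S})) (size (T : {poly S})).
rewrite !(@dop_mulw N) ?leq_maxl ?leq_maxr//; last exact: size_polyD.
by rewrite -big_split; apply: eq_bigr => i _ /=; rewrite -scalerDl -coefD.
Qed.

Fact dop_mul0l Q : dop_mul 0 Q = 0.
Proof. by rewrite /dop_mul size_poly0 big_ord0. Qed.

Fact dop_mulZl f P Q : dop_mul (f *: P) Q = f *: dop_mul P Q.
Proof.
rewrite (@dop_mulw (size (P : {poly S}))) ?size_scale_leq// scaler_sumr.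
by apply: eq_bigr => i _; rewrite scalerA -coefZ.
Qed.

Definition dzX (i : nat) : diffop := 'X^i.

Fact dop_mulXn i Q : dop_mul (dzX i) Q = iter i dz_mul Q.
Proof.
rewrite /dop_mul size_polyXn big_ord_recr /= /dop_coef coefXn eqxx scale1r.
rewrite big1 ?add0r// => j _.
by rewrite coefXn ltn_eqF ?scale0r.
Qed.

Fact dz_mul_additive : zmod_morphism dz_mul.
Proof. by move=> P Q; rewrite /dz_mul mulrBl raddfB addrACA opprD. Qed.
HB.instance Definition _ := GRing.isZmodMorphism.Build diffop diffop dz_mul
  dz_mul_additive.

Fact dz_mulZ f P : dz_mul (f *: P) = f *: dz_mul P + lderiv f *: P.
Proof.
rewrite /dz_mul scalerDr -addrA scalerAl; congr (_ + _).
apply/polyP => i; rewrite coefD !coefZ !coef_map_id0 ?raddf0// coefZ.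
by rewrite lderivM addrC.
Qed.

Fact iter_dz_additive i : zmod_morphism (iter i dz_mul).
Proof. by move=> P Q; elim: i => //= i ->; rewrite raddfB. Qed.
HB.instance Definition _ i := GRing.isZmodMorphism.Build diffop diffop
  (iter i dz_mul) (iter_dz_additive i).

Fact dop_mulDr : right_distributive dop_mul +%R.
Proof.
move=> P Q T; rewrite /dop_mul -big_split; apply: eq_bigr => i _ /=.
by rewrite raddfD scalerDr.
Qed.

Fact dop_mul0r P : dop_mul P 0 = 0.
Proof. by rewrite /dop_mul big1// => i _; rewrite raddf0 scaler0. Qed.

Fact dop_mul_suml (I : Type) (r : seq I) (F : I -> diffop) Q :
  dop_mul (\sum_(i <- r) F i) Q = \sum_(i <- r) dop_mul (F i) Q.
Proof.
by apply: (big_morph (dop_mul^~ Q)) => [P T|]; [exact: dop_mulDl|exact: dop_mul0l].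
Qed.

Fact diffop_expand P :
  P = \sum_(i < size (P : {poly S})) dop_coef P i *: dzX i.
Proof. by rewrite -[LHS](@coefK S) poly_def. Qed.

Fact lderiv1 : lderiv 1 = 0 :> S.
Proof.
apply/laurentP => m /=; case: eqP => [->|]; first by rewrite mulr0z.
by rewrite mul0rz.
Qed.

Fact dz_mulXn i : dz_mul (dzX i) = dzX i.+1.
Proof.
rewrite /dz_mul -exprSr -[RHS]addr0; congr (_ + _); apply/polyP => j.
rewrite coef_map_id0 ?raddf0// coefXn coef0; case: eqP => _.
  exact: lderiv1.
exact: raddf0.
Qed.

Fact dop_mul_dz Q T : dop_mul (dz_mul Q) T = dz_mul (dop_mul Q T).
Proof.
rewrite [in LHS](diffop_expand Q) raddf_sum dop_mul_suml raddf_sum.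
apply: eq_bigr => i _ /=; rewrite !dz_mulZ dop_mulDl !dop_mulZl dop_mulXn.
by rewrite dz_mulXn dop_mulXn.
Qed.

Fact dop_mulA : associative dop_mul.
Proof.
move=> P Q T; rewrite -[LHS]/(\sum_(i < _) _ *: _).
rewrite -[dop_mul P Q]/(\sum_(i < _) _ *: _) dop_mul_suml.
apply: eq_bigr => i _; rewrite dop_mulZl; congr (_ *: _).
by elim: (nat_of_ord i) => //= {}i ->; rewrite dop_mul_dz.
Qed.

Fact dop_mul1l : left_id (1 : {poly S}) dop_mul.
Proof. by move=> P; exact: (dop_mulXn 0 P). Qed.

Fact iter_dz1 i : iter i dz_mul (1 : {poly S}) = dzX i.
Proof. by elim: i => //= i ->; rewrite dz_mulXn. Qed.

Fact dop_mul1r : right_id (1 : {poly S}) dop_mul.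
Proof.
move=> P; rewrite [RHS]diffop_expand; apply: eq_bigr => i _.
by rewrite iter_dz1.
Qed.

Fact diffop_oner_neq0 : (1 : {poly S}) != 0 :> diffop.
Proof. exact: oner_neq0. Qed.

HB.instance Definition _ := GRing.Zmodule_isNzRing.Build diffop
  dop_mulA dop_mul1l dop_mul1r dop_mulDl dop_mulDr diffop_oner_neq0.

Fact dop_series_additive : zmod_morphism dop_series.
Proof. by move=> f g; rewrite /dop_series polyCB. Qed.
HB.instance Definition _ := GRing.isZmodMorphism.Build S diffop dop_series
  dop_series_additive.

Lemma dz_commute f : dz * dop_series f = dop_series f * dz + dop_series (lderiv f).
Proof.
have sZ g : dop_series g = g *: dzX 0.
  by rewrite /dop_series -mul_polyC mulr1.
rewrite -[dz * _]/(dop_mul (dzX 1) _) dop_mulXn /= !sZ.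
rewrite -[_ * dz]/(dop_mul (f *: dzX 0) (dzX 1)) dop_mulZl dop_mulXn /=.
by rewrite dz_mulZ dz_mulXn.
Qed.

Lemma dopE P :
  P = \sum_(i < size (P : {poly S})) dop_series (dop_coef P i) * dz ^+ i.
Proof.
have dzE i : dz ^+ i = dzX i.
  elim: i => // i IH; rewrite exprS IH -[LHS]/(dop_mul (dzX 1) _) dop_mulXn /=.
  exact: dz_mulXn.
rewrite [LHS]diffop_expand; apply: eq_bigr => i _; rewrite dzE.
rewrite [dop_series _](_ : _ = dop_coef P i *: dzX 0).
  by rewrite -[RHS]/(dop_mul _ _) dop_mulZl dop_mulXn.
by rewrite /dop_series -mul_polyC mulr1.
Qed.

Definition dop_le (d : nat) P := (size (P : {poly S}) <= d.+1)%N.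

Fact dop_leD d P Q : dop_le d P -> dop_le d Q -> dop_le d (P + Q).
Proof.
move=> Pd Qd; rewrite /dop_le (leq_trans (size_polyD _ _))// geq_max.
exact/andP.
Qed.

Fact dop_leN d P : dop_le d (- P) = dop_le d P.
Proof. by rewrite /dop_le size_polyN. Qed.

Fact dop_le_sum d (I : Type) (r : seq I) (p : pred I) (F : I -> diffop) :
  (forall i, dop_le d (F i)) -> dop_le d (\sum_(i <- r | p i) F i).
Proof.
move=> Fd; elim/big_ind: _ => //; last exact: dop_leD.
by rewrite /dop_le size_poly0.
Qed.

Fact dop_leM d e P Q : dop_le d P -> dop_le e Q -> dop_le (d + e) (P * Q).
Proof.
move=> Pd Qe; apply: dop_le_sum => i; rewrite /dop_le.
apply: (leq_trans (size_scale_leq _ _)).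
suff: (size (iter i dz_mul Q : {poly S}) <= e.+1 + i)%N.
  by move: (ltn_ord i) Pd; rewrite /dop_le; lia.
elim: (nat_of_ord i) => [|j IH]; first by rewrite addn0.
rewrite iterS /dz_mul (leq_trans (size_polyD _ _))// geq_max.
apply/andP; split; last by rewrite (leq_trans (size_poly _ _))// addnS leqW.
by rewrite (leq_trans (size_polyMleq _ _))// size_polyX addn2 /= addnS ltnS.
Qed.

Fact dop_leE d P : dop_le d P ->
  P = \sum_(i < d.+1) dop_series (dop_coef P i) * dz ^+ i.
Proof.
move=> Pd; rewrite [LHS]dopE.
rewrite (big_ord_widen d.+1 (fun i => dop_series (dop_coef P i) * dz ^+ i) Pd).
rewrite big_mkcond /=; apply: eq_bigr => i _; case: ifPn => //.
rewrite -leqNgt => Pi; rewrite /dop_coef nth_default//.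
by rewrite [dop_series _]raddf0 mul0r.
Qed.

End DiffOp.

Section ColumnDeterminant.
Variables (R : pzRingType) (n : nat).

(* The factors of the product are multiplied in the order of the columns. *)
Definition cdet (N : 'M[R]_n) : R :=
  \sum_(s : 'S_n) (-1) ^+ s * \prod_(j < n) N (s j) j.

End ColumnDeterminant.

Definition subalg_gen (K : fieldType) (A : algType K) (X : set A) : set A :=
  [set x | forall B : {pred A}, GRing.subalg_closed B ->
           (forall y, X y -> y \in B) -> x \in B].

Definition QH_operator (A : nzRingType) n (M : 'M[laurent A]_n) : diffop A :=
  cdet ((dz A)%:M - map_mx (@dop_series A) M).

Lemma QH_operatorE (A : nzRingType) n (M : 'M[laurent A]_n) :
  QH_operator M =
    \sum_(i < n.+1) dop_series (dop_coef (QH_operator M) i) * dz A ^+ i.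
Proof.
apply: dop_leE; apply: dop_le_sum => s.
have prod_le (F : 'I_n -> diffop A) r : (forall j, dop_le 1 (F j)) ->
    dop_le (size r) (\prod_(j <- r) F j).
  move=> F1; elim: r => [|j r IH]; first by rewrite big_nil /dop_le size_poly1.
  by rewrite big_cons -[size _]add1n; apply: dop_leM.
have sgnM (b : bool) (P : diffop A) : (-1) ^+ b * P = if b then - P else P.
  by case: b; rewrite ?expr0 ?expr1 ?mulN1r ?mul1r.
rewrite sgnM; set P := \prod_(j < n) _; suff: dop_le n P.
  by case: (odd_perm s); rewrite ?dop_leN.
have <- : size (index_enum 'I_n) = n.
  by rewrite [index_enum _]unlock -enumT size_enum_ord.
apply: prod_le => j; rewrite !mxE dop_leD ?dop_leN//.
  by case: eqP => _; rewrite ?mulr0n ?mulr1n /dop_le ?size_polyX ?size_poly0.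
by rewrite /dop_le (leq_trans (size_polyC_leq1 _)).
Qed.

Fixpoint qpow (A : nzRingType) n (M : 'M[laurent A]_n) k : 'M[laurent A]_n :=
  if k is k'.+1 then qpow M k' *m M + map_mx (@lderiv A) (qpow M k') else 1%:M.

Section Bethe.
Variables (K : fieldType) (n : nat).

Definition Ugl : algType K := UEA (gl_current K n).

(* Since Negz p = - (p + 1), the coefficient of z^-(p+1) is e_{k,l} t^p. *)
Fact Lgl_subproof (k l : 'I_n) : exists N : nat, forall m : int, N%:Z < m ->
  (if m is Negz p then uea_inj (gl_elt K k l p) else 0 : Ugl) = 0.
Proof. by exists 0%N => -[]. Qed.

Definition Lgl : 'M[laurent Ugl]_n :=
  \matrix_(k, l) Laurent (Lgl_subproof k l).

Definition QH (i : nat) : laurent Ugl := dop_coef (QH_operator Lgl) i.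

(* Commutativity of this subalgebra is a theorem, not part of the definition. *)
Definition bethe : set Ugl :=
  subalg_gen [set x | exists i (m : int), (i <= n)%N /\ x = QH i m].

End Bethe.

Arguments bethe : clear implicits.
Arguments Lgl : clear implicits.

(* Main.v *)
(* Write [M = d/dz - L(z)], so that [det M = sum_k h_k (d/dz)^k].  The
   commutation relations of [gl_n[t]] make [M] a Manin matrix, hence its column
   determinant is alternating in the columns and [adj(M) M = det M].  Modulo the
   left ideal generated by [M], [(d/dz)^k] reduces to the quantum power [L^[k]];
   dividing [det M] by [M] on the right therefore yields both the
   Cayley-Hamilton identity [sum_k h_k L^[k] = 0] and
   [adj(M) = sum_k h_k sum_(i < k) (d/dz)^(k-1-i) L^[i]].  The trace of [adj(M)]
   is the derivative of [det M] with respect to [d/dz], i.e. its commutator with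
   [z], and comparing coefficients gives Newton identities which are triangular
   between the [h_k] and the traces [Tr L^[k]], with no commutativity of the
   Bethe subalgebra needed. *)
Require Import Defs.
From HB Require Import structures.
From mathcomp Require Import all_boot all_order all_algebra perm.
From mathcomp Require Import complex zify.
From mathcomp Require Import classical_sets fsbigop reals.

Set Implicit Arguments.
Unset Strict Implicit.
Unset Printing Implicit Defensive.

Import GRing.Theory Num.Theory.

Local Open Scope ring_scope.

(** * Column determinants and adjugates of Manin matrices *)

Section ManinMatrix.
Variable R : pzRingType.

Definition manin n (M : 'M[R]_n) := forall i j k l,
  M i j * M k l - M k l * M i j = M k j * M i l - M i l * M k j.

Lemma colsub_manin n (f : 'I_n -> 'I_n) (M : 'M[R]_n) :
  manin M -> manin (colsub f M).
Proof. by move=> MM i j k l; rewrite !mxE. Qed.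

Lemma col_perm_manin n (s : 'S_n) (M : 'M[R]_n) :
  manin M -> manin (col_perm s M).
Proof. by move=> MM i j k l; rewrite !mxE. Qed.

(** Nothing stands between the adjacent positions [a] and [b], so an identity between two-factor
    products can be multiplied on both sides by the factors that all four products share. *)
Lemma prod_adjacentD n (a b : 'I_n) (F1 F2 F3 F4 : 'I_n -> R) :
    b = a.+1 :> nat ->
    (forall j, j != a -> j != b -> [/\ F1 j = F2 j, F3 j = F2 j & F4 j = F2 j]) ->
    F1 a * F1 b + F2 a * F2 b = F3 a * F3 b + F4 a * F4 b ->
  \prod_j F1 j + \prod_j F2 j = \prod_j F3 j + \prod_j F4 j.
Proof.
move=> ab Fab Eab.
have bn := ltn_ord b; have inn (k : nat) : (k < n)%N -> 'I_n by exact: Ordinal.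
(* Extending [F] to all naturals, by [F a] out of range, lets the product be cut at natural-number
   bounds. *)
pose ext (F : 'I_n -> R) (k : nat) := F (insubd a k).
have extE F (k : 'I_n) : ext F k = F k by rewrite /ext valKd.
have split_prod F : \prod_j F j = \prod_(0 <= k < a) ext F k * (F a * F b)
    * \prod_(b.+1 <= k < n) ext F k.
  under eq_bigr do rewrite -extE.
  rewrite -(big_mkord predT) (big_cat_nat (n := a))//=; last by rewrite ltnW.
  rewrite (big_ltn (m := a))// -ab (big_ltn (m := b))//.
  by rewrite !extE !mulrA.
have eq_out F G : (forall j, j != a -> j != b -> F j = G j) ->
    \prod_(0 <= k < a) ext F k = \prod_(0 <= k < a) ext G k /\
    \prod_(b.+1 <= k < n) ext F k = \prod_(b.+1 <= k < n) ext G k.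
  move=> FG; split; apply: eq_big_nat => k kab; apply: FG;
    rewrite -val_eqE val_insubd /=; case: ifP; lia.
have [l1 r1] := eq_out F1 F2 (fun j ja jb => let: And3 e _ _ := Fab j ja jb in e).
have [l3 r3] := eq_out F3 F2 (fun j ja jb => let: And3 _ e _ := Fab j ja jb in e).
have [l4 r4] := eq_out F4 F2 (fun j ja jb => let: And3 _ _ e := Fab j ja jb in e).
rewrite !split_prod l1 l3 l4 r1 r3 r4.
by rewrite -!mulrDl -!mulrDr Eab.
Qed.

(** Multiplication by [tperm a b] pairs even permutations with odd ones, and the terms cancel in
    pairs without any division by 2. *)
Lemma sum_sign_tperm n (a b : 'I_n) (G : 'S_n -> R) :
    a != b -> (forall s, G (tperm a b * s)%g = G s) ->
  \sum_(s : 'S_n) (-1) ^+ s * G s = 0.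
Proof.
move=> ab Gt; rewrite (bigID (@odd_perm _)) /=.
apply: canLR (subrK _) _; rewrite add0r -sumrN.
rewrite (reindex_inj (mulgI (tperm a b))); apply: eq_big => /= s.
  by rewrite odd_permM odd_tperm ab.
rewrite odd_permM odd_tperm ab /= => /negPf ->.
by rewrite Gt mulN1r mul1r.
Qed.

(** In the sum of both determinants, the Manin relation for rows [s a], [s b] and columns [a], [b]
    makes the combined products for [s] and [tperm a b * s] equal, while their signs differ. *)
Lemma cdet_adjacent n (M : 'M[R]_n) (a b : 'I_n) : b = a.+1 :> nat ->
  manin M -> cdet (col_perm (tperm a b) M) = - cdet M.
Proof.
move=> ab MM; have nab : a != b by rewrite -val_eqE /= ab ltn_eqF.
apply/eqP; rewrite -addr_eq0 -big_split /=; apply/eqP.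
under eq_bigr do rewrite -mulrDr.
apply: (sum_sign_tperm nab) => s.
apply: (prod_adjacentD ab) => [j ja jb|].
  by rewrite !mxE !permM !tpermD // eq_sym.
rewrite !mxE !permM !tpermL !tpermR.
by have /eqP := MM (s b) b (s a) a; rewrite subr_eq addrAC eq_sym subr_eq => /eqP.
Qed.

(** Induction on the distance: conjugating by the transposition of [a] and [a.+1] brings the two
    columns closer, and three sign changes amount to one. *)
Lemma cdet_tperm n (M : 'M[R]_n) (a b : 'I_n) : a != b ->
  manin M -> cdet (col_perm (tperm a b) M) = - cdet M.
Proof.
wlog ab : a b / (a < b)%N => [IH nab|].
  by have [ab|ab|/val_inj/eqP] := ltngtP a b;
    [exact: IH|rewrite tpermC; apply: IH; rewrite // eq_sym|rewrite (negPf nab)].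
have [d] := ubnP (b - a); elim: d => // d IH in a b ab M *.
rewrite ltnS => ltd nab MM.
have [ba|nba] := eqVneq (b : nat) a.+1; first exact: cdet_adjacent.
have ltc : (a.+1 < n)%N by apply: leq_ltn_trans (ltn_ord b).
pose c := Ordinal ltc.
have cb : c != b by rewrite -val_eqE /= eq_sym.
have -> : tperm a b = (tperm a c * (tperm c b * tperm a c))%g.
  by rewrite -{1}(tpermV a c) -/(conjg _ _) tpermJ tpermR tpermD.
rewrite !col_permM cdet_adjacent//; last by do 2!apply: col_perm_manin.
rewrite IH//=; [|by lia|by move: ltd => /=; lia|exact: col_perm_manin].
by rewrite cdet_adjacent// opprK.
Qed.

Lemma cdet_col_perm n (M : 'M[R]_n) (t : 'S_n) :
  manin M -> cdet (col_perm t M) = (-1) ^+ t * cdet M.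
Proof.
case: (prod_tpermP t) => ts ->{t}; elim: ts M => [|[a b] ts IH] M /=.
  by rewrite big_nil odd_perm1 col_perm1 mul1r.
move=> /andP[nab dts] MM; rewrite big_cons odd_permM odd_tperm nab.
rewrite col_permM /= cdet_tperm//; last exact: col_perm_manin.
by rewrite IH// signrN mulNr.
Qed.

(** Exchanging the equal columns only shows that the determinant is its own opposite; its vanishing
    is drawn later from the absence of 2-torsion. *)
Lemma cdet_eq_col n (M : 'M[R]_n) (a b : 'I_n) : a != b ->
  (forall i, M i a = M i b) -> manin M -> cdet M *+ 2 = 0.
Proof.
move=> nab Mab MM; rewrite mulr2n -[X in X + _]opprK -(cdet_tperm nab MM).
rewrite (_ : col_perm _ M = M) ?addNr//.
by apply/matrixP => i j; rewrite mxE; case: tpermP => // ->.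
Qed.

Lemma sum_lift_perm (V : zmodType) n (F : 'S_n.+1 -> V) i0 j0 :
  \sum_(s : 'S_n.+1 | s i0 == j0) F s = \sum_(t : 'S_n) F (lift_perm i0 j0 t).
Proof.
rewrite (reindex (lift_perm i0 j0)) /=.
  by apply: eq_bigl => s; rewrite lift_perm_id eqxx.
(* The inverse of [lift_perm] deletes [i0] and its image; the default of [odflt] is never reached,
   since [s i0] differs from [s (lift i0 k)]. *)
have lift_inj_perm (s : 'S_n.+1) : injective
    (fun k => odflt k (unlift (s i0) (s (lift i0 k)))).
  move=> k l; have neq m : s i0 != s (lift i0 m).
    by rewrite (inj_eq perm_inj) neq_lift.
  case/unlift_some: (neq k) => k' ek ->; case/unlift_some: (neq l) => l' el -> /= kl.
  by apply/(@lift_inj _ i0)/(@perm_inj _ s); rewrite ek el kl.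
exists (fun s => perm (@lift_inj_perm s)) => [t _|s].
  by apply/permP => k; rewrite permE lift_perm_lift lift_perm_id liftK.
rewrite inE => /eqP si0; apply/permP => k.
case: (unliftP i0 k) => [k'|] ->; last by rewrite lift_perm_id.
have neq : s i0 != s (lift i0 k') by rewrite (inj_eq perm_inj) neq_lift.
by rewrite lift_perm_lift permE -si0; case/unlift_some: neq => l' el ->.
Qed.

(** The last column supplies the rightmost factor of every product, so its entries factor out on the
    right without any commutation. *)
Lemma cdet_expand_last n (N : 'M[R]_n.+1) :
  cdet N =
    \sum_(i < n.+1) (-1) ^+ (i + n)%N * cdet (row' i (col' ord_max N)) * N i ord_max.
Proof.
rewrite /(cdet N) (partition_big (fun s : 'S_n.+1 => s ord_max) predT) //=.
apply: eq_bigr => i _; rewrite sum_lift_perm mulr_sumr mulr_suml.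
apply: eq_bigr => t _; rewrite big_ord_recr /= lift_perm_id !mulrA.
congr (_ * _ * _).
  rewrite odd_lift_perm -[(-1) ^+ (i + n)%N]signr_odd -signr_addb oddD.
  by rewrite [odd i (+) _]addbC.
apply: eq_bigr => k _; rewrite !mxE.
rewrite (_ : widen_ord _ _ = lift ord_max k) ?lift_perm_lift//.
by apply: val_inj; rewrite /= /bump leqNgt ltn_ord.
Qed.

Definition cadj n (M : 'M[R]_n) : 'M[R]_n :=
  \matrix_(i, j) ((-1) ^+ (i + j)%N * cdet (row' j (col' i M))).

(** Row [i] of the adjugate against column [k] of [M] expands, up to sign, the determinant of [M]
    with column [i] deleted and column [k] appended at the end. *)
Lemma cadj_mul n (M : 'M[R]_n) : (forall x : R, x *+ 2 = 0 -> x = 0) ->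
  manin M -> cadj M *m M = (cdet M)%:M.
Proof.
case: n => [|n] in M *; first by move=> _ _; apply/matrixP => -[].
move=> reg2 MM; apply/matrixP => i k; rewrite mxE [RHS]mxE.
(* [f c] lists the columns other than [i] in order and puts [c] last. *)
pose f (c : 'I_n.+1) (x : 'I_n.+1) := oapp (lift i) c (unlift ord_max x).
have fl c x : f c (lift ord_max x) = lift i x by rewrite /f liftK.
have fm c : f c ord_max = c by rewrite /f unlift_none.
have -> : \sum_j cadj M i j * M j k = (-1) ^+ (i + n)%N * cdet (colsub (f k) M).
  rewrite cdet_expand_last mulr_sumr; apply: eq_bigr => j _.
  rewrite !mxE fm !mulrA -exprD; congr (_ * _ * _).
    rewrite -[LHS]signr_odd -[RHS]signr_odd !oddD.
    by case: (odd i) (odd j) (odd n) => -[] [].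
  by congr cdet; apply/matrixP => x y; rewrite !mxE fl.
(* For [i = k] the columns are permuted with sign $(-1)^{i+n}$, which cancels the prefactor;
   otherwise column [k] occurs twice. *)
have [<-|nik] := eqVneq i k.
  have -> : colsub (f i) M = col_perm (lift_perm ord_max i 1) M.
    apply/matrixP => x y; rewrite !mxE; congr (M _ _).
    case: (unliftP ord_max y) => [y'|] ->; rewrite ?fl ?fm ?lift_perm_id//.
    by rewrite lift_perm_lift perm1.
  rewrite cdet_col_perm// odd_lift_perm odd_perm1 addbF mulr1n.
  rewrite mulrA -[(-1) ^+ (i + n)%N]signr_odd -signr_addb oddD.
  by rewrite [odd i (+) _]addbC addbb mul1r.
rewrite mulr0n; case/unlift_some: nik => k' ek _.
rewrite (reg2 (cdet _)) ?mulr0//.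
apply: (@cdet_eq_col _ _ (lift ord_max k') ord_max).
- by rewrite eq_sym neq_lift.
- by move=> x; rewrite !mxE fl fm ek.
- exact: colsub_manin.
Qed.

Section Derivation.
Variable delta : {additive R -> R}.
Hypothesis deltaM : forall x y, delta (x * y) = delta x * y + x * delta y.

(** By the Leibniz rule: a factor of derivative 1 simply disappears from the product, whence
    [lift i]. *)
Lemma derivation_prod n (F : 'I_n.+1 -> R) (c : 'I_n.+1 -> bool) :
    (forall j, delta (F j) = (c j)%:R) ->
  delta (\prod_j F j) = \sum_(i | c i) \prod_k F (lift i k).
Proof.
elim: n => [|n IH] in F c * => Fc.
  rewrite big_ord_recl big_ord0 mulr1 Fc big_mkcond big_ord_recl !big_ord0 /= addr0.
  by case: (c ord0).
rewrite big_ord_recl deltaM Fc (IH _ (fun j => c (lift ord0 j)))//.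
rewrite [RHS]big_mkcond [RHS]big_ord_recl /=; congr (_ + _).
  by case: (c ord0); rewrite ?mul1r ?mul0r.
rewrite mulr_sumr [LHS]big_mkcond; apply: eq_bigr => i _; case: ifP => // _.
rewrite [RHS]big_ord_recl; congr (_ * _); first by congr F; apply: val_inj.
by apply: eq_bigr => k _; congr F; apply: val_inj;
  rewrite /= /bump !add1n ltnS addnS.
Qed.

(** Differentiating the factor in column [i] retains the permutations fixing [i] and leaves the
    principal minor without row and column [i], a diagonal entry of [cadj M]. *)
Lemma derivation_cdet n (M : 'M[R]_n) : (forall i j, delta (M i j) = (i == j)%:R) ->
  delta (cdet M) = \tr (cadj M).
Proof.
case: n => [|n] in M * => dM.
  have /eqP := deltaM 1 1; rewrite !mulr1 mul1r -subr_eq subrr eq_sym => /eqP d1.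
  rewrite /mxtrace big_ord0 raddf_sum big1// => s _.
  by rewrite big_ord0 mulr_sign; case: ifP; rewrite ?raddfN d1 ?oppr0.
rewrite raddf_sum /=.
transitivity (\sum_(s : 'S_n.+1) \sum_(i | s i == i)
    (-1) ^+ s * \prod_k M (s (lift i k)) (lift i k)).
  apply: eq_bigr => s _; rewrite -mulr_sumr.
  rewrite -(derivation_prod (F := fun k => M (s k) k) (c := fun i => s i == i))//.
  by rewrite !mulr_sign; case: ifP => // _; rewrite raddfN.
rewrite (exchange_big_dep predT) //=; apply: eq_bigr => i _.
rewrite sum_lift_perm mxE -signr_odd oddD addbb mul1r.
apply: eq_bigr => t _; rewrite odd_lift_perm addbb; congr (_ * _).
by apply: eq_bigr => k _; rewrite lift_perm_lift !mxE.
Qed.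

End Derivation.

End ManinMatrix.

(** * Coefficients of differential operators and the derivative in [dz] *)

Section DiffOpFacts.
Variable A : nzRingType.
Implicit Types (f g : laurent A) (P Q : diffop A).

Local Notation dz := (dz A).
Local Notation ser := (@dop_series A).

Lemma lcoefN f m : (- f) m = - f m.
Proof. by []. Qed.

Lemma lcoefMb f (b : bool) m : (f *+ b) m = f m *+ b.
Proof. by case: b. Qed.

Lemma lcoef_mul_z f m : (f * lmonom 1 1) m = f (m - 1).
Proof.
rewrite lcoefM (fsum_delta (k := m - 1)) => [|i im] /=.
  by rewrite (_ : m - (m - 1) = 1) ?eqxx ?mulr1//; lia.
by case: eqP; rewrite ?mulr0//; lia.
Qed.

Lemma lcoef_z_mul f m : (lmonom 1 1 * f) m = f (m - 1).
Proof.
rewrite lcoefM (fsum_delta (k := 1)) => [|i /negPf i1] /=.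
  by rewrite mul1r.
by rewrite i1 mul0r.
Qed.

Lemma lderiv_z : lderiv (lmonom 1 1) = 1 :> laurent A.
Proof.
apply/laurentP => m /=; rewrite -[X in _ == X]add0r (inj_eq (addIr 1)).
by case: eqP => [->|]; rewrite ?mul0rz.
Qed.

Lemma dop_seriesME f P : ser f * P = f *: P.
Proof.
rewrite (_ : ser f = f *: dzX A 0); last first.
  by rewrite /dop_series -mul_polyC mulr1.
by rewrite -[LHS]/(dop_mul _ _) dop_mulZl dop_mulXn.
Qed.

Lemma dzME P : dz * P = dz_mul P.
Proof. exact: dop_mulXn 1%N P. Qed.

Lemma dop_series1 : ser 1 = 1.
Proof. by []. Qed.

Lemma dop_seriesM f g : ser (f * g) = ser f * ser g.
Proof. by rewrite dop_seriesME /dop_series polyCM mul_polyC. Qed.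

Lemma dop_coefD P Q i : dop_coef (P + Q) i = dop_coef P i + dop_coef Q i.
Proof. exact: coefD. Qed.

Lemma dop_coefB P Q i : dop_coef (P - Q) i = dop_coef P i - dop_coef Q i.
Proof. exact: coefB. Qed.

Lemma dop_coefN P i : dop_coef (- P) i = - dop_coef P i.
Proof. exact: coefN. Qed.

Lemma dop_coef1 : dop_coef (1 : diffop A) 0 = 1.
Proof. exact: coefC. Qed.

Lemma dop_coef0 i : dop_coef (0 : diffop A) i = 0.
Proof. exact: coef0. Qed.

Lemma dop_coef_sum I (r : seq I) (p : pred I) (F : I -> diffop A) i :
  dop_coef (\sum_(j <- r | p j) F j) i = \sum_(j <- r | p j) dop_coef (F j) i.
Proof.
elim/big_rec2: _ => [|j f P _ <-]; [exact: dop_coef0|exact: dop_coefD].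
Qed.

Lemma dop_coefMn P k i : dop_coef (P *+ k) i = dop_coef P i *+ k.
Proof. exact: coefMn. Qed.

Lemma dop_coefZ f P i : dop_coef (ser f * P) i = f * dop_coef P i.
Proof. by rewrite dop_seriesME; exact: coefZ. Qed.

Lemma dop_coef_series f i : dop_coef (ser f) i = if i == 0%N then f else 0.
Proof. exact: coefC. Qed.

Lemma dop_coef_dzM P i : dop_coef (dz * P) i =
  (if i is i'.+1 then dop_coef P i' else 0) + lderiv (dop_coef P i).
Proof.
rewrite dzME /dz_mul -[LHS]/(_`_i) coefD coefMX coef_map_id0 ?raddf0//.
by case: i.
Qed.

Lemma dop_coefMdz P i :
  dop_coef (P * dz) i = if i is i'.+1 then dop_coef P i' else 0.
Proof.
rewrite -[P * dz]/(dop_mul P (dzX A 1)).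
rewrite (_ : dop_mul _ _ = (P : {poly _}) * 'X).
  by rewrite /dop_coef coefMX; case: i.
rewrite [in RHS](diffop_expand P) mulr_suml; apply: eq_bigr => k _.
rewrite -scalerAl; congr (_ *: _); rewrite -[_ * 'X]exprSr.
by elim: {k}(nat_of_ord k) => //= k ->; rewrite dz_mulXn.
Qed.

Lemma dop_coefXn k i : dop_coef (dz ^+ k) i = (i == k)%:R.
Proof.
elim: k i => [|k IH] i.
  by rewrite expr0 -dop_series1 dop_coef_series; case: eqP.
by rewrite exprSr dop_coefMdz; case: i.
Qed.

Lemma dop_coef_gt d P i : dop_le d P -> (d < i)%N -> dop_coef P i = 0.
Proof. by move=> Pd di; apply: nth_default; apply: leq_trans di. Qed.

Lemma dop_le0 f : dop_le 0 (ser f).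
Proof. exact: size_polyC_leq1. Qed.

(** Moving [f] to the left of [dz ^+ k] only produces terms of order at most [k]; this vanishing
    makes the Newton identities triangular. *)
Lemma dop_coef_dzXM_gt f k i : (k < i)%N -> dop_coef (dz ^+ k * ser f) i = 0.
Proof.
elim: k i => [|k IH] [|i] // ki; first by rewrite expr0 mul1r dop_coef_series.
by rewrite exprS -mulrA dop_coef_dzM !IH ?raddf0 ?addr0//; apply: ltnW.
Qed.

Lemma dop_coef_dzXM f k : dop_coef (dz ^+ k * ser f) k = f.
Proof.
elim: k => [|k IH]; first by rewrite expr0 mul1r dop_coef_series.
rewrite exprS -mulrA dop_coef_dzM IH dop_coef_dzXM_gt//.
by rewrite raddf0 addr0.
Qed.

Lemma dop_reg2 : (forall x : A, x *+ 2 = 0 -> x = 0) ->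
  forall P, P *+ 2 = 0 -> P = 0.
Proof.
move=> reg2 P P2; apply/polyP => i; apply/laurentP => m; rewrite coef0.
apply: reg2; have /(congr1 (fun Q => lcoef (dop_coef Q i) m)) := P2.
by rewrite dop_coef0 mulr2n dop_coefD => e; rewrite mulr2n.
Qed.

(** [lmonom 1 1] is the series $z$: the commutator with it kills series and sends [dz] to 1, so it
    acts as the derivative in [dz]. *)
Definition dop_deriv P := P * ser (lmonom 1 1) - ser (lmonom 1 1) * P.

Fact dop_deriv_additive : zmod_morphism dop_deriv.
Proof. by move=> P Q; rewrite /dop_deriv mulrBl mulrBr opprD addrACA -opprD. Qed.
HB.instance Definition _ := GRing.isZmodMorphism.Build (diffop A) (diffop A)
  dop_deriv dop_deriv_additive.

Lemma dop_derivM P Q : dop_deriv (P * Q) = dop_deriv P * Q + P * dop_deriv Q.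
Proof. by rewrite /dop_deriv mulrBl mulrBr !mulrA [RHS]addrC addrA subrK. Qed.

Lemma dop_deriv_dz : dop_deriv dz = 1.
Proof. by rewrite /dop_deriv dz_commute addrAC subrr add0r lderiv_z. Qed.

Lemma dop_deriv_series f : dop_deriv (ser f) = 0.
Proof.
rewrite /dop_deriv -!dop_seriesM -raddfB (_ : _ - _ = 0) ?raddf0//.
apply/eqP; rewrite subr_eq0; apply/eqP/laurentP => m.
by rewrite lcoef_mul_z lcoef_z_mul.
Qed.

Lemma dop_deriv_monom f k : dop_deriv (ser f * dz ^+ k) = ser f * dz ^+ k.-1 *+ k.
Proof.
rewrite dop_derivM dop_deriv_series mul0r add0r.
suff -> : dop_deriv (dz ^+ k) = dz ^+ k.-1 *+ k by rewrite mulrnAr.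
elim: k => [|k IH]; first by rewrite expr0 mulr0n -dop_series1 dop_deriv_series.
rewrite exprS dop_derivM dop_deriv_dz mul1r IH mulrnAr mulrS; congr (_ + _).
by case: k {IH} => // k; rewrite -exprS.
Qed.

End DiffOpFacts.

(** * Right division by $d/dz - L$, Cayley-Hamilton and Newton identities *)

Section QuantumPowers.
Variables (A : nzRingType) (n : nat) (L : 'M[laurent A]_n).
Local Notation dz := (dz A).
Local Notation ser := (@dop_series A).
Local Notation ser_mx := (map_mx ser).
Local Notation M := (dz%:M - ser_mx L).
Local Notation h k := (dop_coef (QH_operator L) k).
Local Notation tau k := (\tr (qpow L k)).

Lemma ser_mxM m p q (X : 'M_(m, p)) (Y : 'M_(p, q)) :
  ser_mx (X *m Y) = ser_mx X *m ser_mx Y.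
Proof.
apply/matrixP => i j; rewrite !mxE raddf_sum; apply: eq_bigr => k _.
by rewrite !mxE /= dop_seriesM.
Qed.

Lemma dz_ser_mx (X : 'M_n) :
  dz%:M *m ser_mx X = ser_mx X *m dz%:M + ser_mx (map_mx (@lderiv A) X).
Proof.
apply/matrixP => i j; rewrite mul_scalar_mx !mxE.
rewrite (bigD1 j)//= !mxE eqxx mulr1n big1 => [|k kj]; last first.
  by rewrite !mxE (negPf kj) mulr0n mulr0.
by rewrite addr0 dz_commute.
Qed.

(** Noncommutative analogue of $(x^k-y^k)/(x-y)$: the quotient in the right division of [dz ^+ k] by
    [M]. *)
Definition qquot k : 'M[diffop A]_n :=
  \sum_(i < k) (dz ^+ (k.-1 - i))%:M *m ser_mx (qpow L i).

Lemma qquotS k : qquot k.+1 = dz%:M *m qquot k + ser_mx (qpow L k).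
Proof.
rewrite /qquot big_ord_recr /= subnn expr0 mul1mx; congr (_ + _).
rewrite mulmx_sumr; apply: eq_bigr => i _.
rewrite mulmxA -scalar_mxM -exprS; congr ((dz ^+ _)%:M *m _).
by have := ltn_ord i; lia.
Qed.

(* Right division of [dz ^+ k] by [M]: modulo the left ideal generated by [M],
   [dz] acts on series by [X |-> X L + X']. *)
Lemma qpow_division k : (dz ^+ k)%:M = qquot k *m M + ser_mx (qpow L k).
Proof.
elim: k => [|k IH].
  rewrite /qquot big_ord0 mul0mx add0r expr0; apply/matrixP => i j.
  by rewrite !mxE; case: eqP => _; rewrite ?raddf0.
rewrite exprS scalar_mxM IH mulmxDr mulmxA dz_ser_mx qquotS mulmxDl -addrA.
congr (_ + _); rewrite mulmxBr -ser_mxM raddfD /=.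
by rewrite [RHS]addrA subrK.
Qed.

(** Uniqueness of right division by [M]: the top coefficient of [B] reappears one order higher in
    [B *m M], where a matrix of series has only zeros, so the bound [d] descends to 0. *)
Lemma dop_le_mul_eq0 d (B : 'M[diffop A]_n) (X : 'M_n) :
  (forall i j, (size (B i j : {poly _}) <= d)%N) -> B *m M = ser_mx X -> B = 0.
Proof.
elim: d => [|d IH] Bd BM.
  apply/matrixP => i j; rewrite mxE; apply/eqP.
  by have := Bd i j; rewrite leqn0 size_poly_eq0.
apply: IH => // i j; apply/leq_sizeP => k.
rewrite leq_eqVlt => /predU1P[<-|dk]; last first.
  exact: dop_coef_gt (Bd i j) dk.
have /(congr1 (fun P : 'M[diffop A]_n => dop_coef (P i j) d.+1)) := BM.
rewrite mulmxBr !mxE dop_coefB dop_coef_series dop_coef_sum /= (bigD1 j)//=.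
rewrite big1 => [|l lj]; last by rewrite !mxE (negPf lj) mulr0n mulr0 dop_coef0.
rewrite !mxE eqxx mulr1n dop_coefMdz addr0 dop_coef_sum big1 ?subr0// => l _.
rewrite mxE (dop_coef_gt (d := d))// -[d in dop_le d]addn0.
by apply: dop_leM; [exact: Bd|exact: dop_le0].
Qed.

Lemma QH_operator_expand :
  (QH_operator L)%:M = (\sum_(k < n.+1) (ser (h k))%:M *m qquot k) *m M
    + ser_mx (\sum_(k < n.+1) h k *: qpow L k) :> 'M_n.
Proof.
rewrite {1}QH_operatorE raddf_sum mulmx_suml raddf_sum -big_split /=.
apply: eq_bigr => k _; rewrite scalar_mxM qpow_division mulmxDr mulmxA.
congr (_ + _); apply/matrixP => i j; rewrite mul_scalar_mx !mxE.
by rewrite dop_seriesM.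
Qed.

Hypothesis reg2 : forall x : A, x *+ 2 = 0 -> x = 0.
Hypothesis M_manin : manin M.

(** Both [cadj M] and the combination of the [qquot k] are right quotients of the determinant by
    [M]; uniqueness of the division identifies first the quotients, then the remainders. *)
Lemma cadj_quotient :
  cadj M = \sum_(k < n.+1) (ser (h k))%:M *m qquot k
  /\ \sum_(k < n.+1) h k *: qpow L k = 0.
Proof.
set B := \sum_(k < n.+1) _ *m _; set C := \sum_(k < n.+1) _.
have BC : (cadj M - B) *m M = ser_mx C.
  rewrite mulmxBl cadj_mul//; last exact: dop_reg2.
  by rewrite -[cdet M]/(QH_operator L) QH_operator_expand addrAC subrr add0r.
have B0 : cadj M - B = 0.
  move: (cadj M - B) BC => D DC.
  pose sz i j := size (D i j : {poly _}).
  apply: (@dop_le_mul_eq0 (\max_i \max_j sz i j) _ C _ DC) => i j.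
  by apply: leq_trans (leq_bigmax i); apply: (leq_bigmax (F := sz i) j).
split; first by apply/eqP; rewrite -subr_eq0 B0.
apply/matrixP => i j.
have /(congr1 (fun P : 'M[diffop A]_n => dop_coef (P i j) 0)) := BC.
by rewrite B0 mul0mx !mxE dop_coef0 dop_coef_series.
Qed.

Lemma quantum_Cayley_Hamilton : \sum_(k < n.+1) h k *: qpow L k = 0.
Proof. by have [] := cadj_quotient. Qed.

(** This is the coefficient of [dz ^+ m] in the equality between the trace of the adjugate, written
    through the quotients, and the [dz]-derivative of the determinant. *)
Lemma quantum_Newton m : (m < n)%N ->
  \sum_(k < n.+1) h k *
     \sum_(i < k) dop_coef (dz ^+ (k.-1 - i) * ser (tau i)) m
  = h m.+1 *+ m.+1.
Proof.
move=> mn; have [cE _] := cadj_quotient.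
have : dop_deriv (QH_operator L) = \tr (cadj M).
  apply: (derivation_cdet (@dop_derivM A)) => i j.
  rewrite !mxE raddfB /= dop_deriv_series subr0; case: eqP => _.
    by rewrite mulr1n dop_deriv_dz.
  by rewrite mulr0n raddf0.
rewrite cE {1}QH_operatorE !raddf_sum /= => /(congr1 (fun P => dop_coef P m)) e.
rewrite !dop_coef_sum in e; transitivity (\sum_(k < n.+1)
    dop_coef (\tr ((ser (h k))%:M *m qquot k)) m).
  apply: eq_bigr => k _; rewrite mul_scalar_mx mxtraceZ dop_coefZ; congr (_ * _).
  rewrite /qquot raddf_sum dop_coef_sum /=; apply: eq_bigr => i _.
  rewrite mul_scalar_mx mxtraceZ; congr (dop_coef (_ * _) _).
  by rewrite /mxtrace raddf_sum; apply: eq_bigr => j _; rewrite mxE.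
rewrite -e.
(* Differentiating [dz ^+ k] yields order [m] only for [k = m.+1]. *)
have mn1 : (m.+1 < n.+1)%N by [].
rewrite (bigD1 (Ordinal mn1))//= big1 => [|k km].
  rewrite addr0 dop_deriv_monom dop_coefMn dop_coefZ dop_coefXn eqxx.
  by rewrite mulr1.
rewrite dop_deriv_monom dop_coefMn dop_coefZ dop_coefXn.
case: k km => -[|k] kn; first by rewrite mulr0n.
by rewrite -val_eqE /= eqSS eq_sym => /negPf ->; rewrite mulr0 mul0rn.
Qed.

End QuantumPowers.

(** * Leading coefficient of the determinant and a Manin criterion for $d/dz - L$ *)

Section LaxCommutator.
Variables (A : nzRingType) (n : nat).
Local Notation dz := (dz A).
Local Notation ser := (@dop_series A).

(** A product reaches order [n] only if every factor contains [dz], that is, for the identity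
    permutation. *)
Lemma QH_operator_lead (L : 'M[laurent A]_n) : dop_coef (QH_operator L) n = 1.
Proof.
have prod_lead (c : 'I_n -> bool) (f : 'I_n -> laurent A) (r : seq 'I_n) :
    let P := \prod_(j <- r) (dz *+ c j - ser (f j)) in
    dop_le (size r) P /\ dop_coef P (size r) = (all c r)%:R.
  elim: r => [|j r [IHd IHc]] P.
    by rewrite /P big_nil /dop_le size_poly1 dop_coef1.
  set Q := \prod_(j <- r) _ in IHd IHc.
  have PE : P = (dz *+ c j - ser (f j)) * Q by rewrite /P big_cons.
  split.
    rewrite PE /= -[(size r).+1]add1n; apply: dop_leM => //.
    rewrite dop_leD ?dop_leN//.
      by case: (c j); rewrite /dop_le ?size_polyX ?size_poly0.
    by rewrite /dop_le (leq_trans (size_polyC_leq1 _)).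
  rewrite PE mulrBl mulrnAl dop_coefB dop_coefMn dop_coefZ dop_coef_dzM /=.
  rewrite (dop_coef_gt IHd (ltnSn _)) IHc raddf0 mulr0 subr0 addr0.
  by case: (c j) (all c r) => -[].
have nE : size (index_enum 'I_n) = n.
  by rewrite [index_enum _]unlock -enumT size_enum_ord.
rewrite dop_coef_sum (bigD1 (1%g : 'S_n))//= [X in _ + X]big1 => [|s s1].
  rewrite addr0 odd_perm1 expr0 mul1r.
  under eq_bigr do rewrite !mxE.
  pose e : 'S_n := 1%g.
  have [_] := prod_lead (fun j => e j == j) (fun j => L (e j) j) (index_enum _).
  by rewrite nE => ->; rewrite (_ : all _ _)//; apply/allP => j _; rewrite perm1.
have [_] := prod_lead (fun j => s j == j) (fun j => L (s j) j) (index_enum _).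
rewrite nE (_ : all _ _ = false) => [e|].
  rewrite mulr_sign; under eq_bigr do rewrite !mxE.
  by case: ifP; rewrite ?dop_coefN e ?oppr0.
apply: contraNF s1 => /allP s1; apply/eqP/permP => j; rewrite perm1.
by apply/eqP/s1; rewrite mem_index_enum.
Qed.

(** The booleans mark the diagonal entries, where [dz] occurs, so that one formula covers all
    entries of $d/dz - L$. *)
Lemma dz_series_commutator (b c : bool) (f g : laurent A) :
  (dz *+ b - ser f) * (dz *+ c - ser g) - (dz *+ c - ser g) * (dz *+ b - ser f)
  = ser (lderiv f *+ c - lderiv g *+ b + (f * g - g * f)).
Proof.
have bracketBB (X Y F G : diffop A) : X * Y = Y * X ->
    (X - F) * (Y - G) - (Y - G) * (X - F) =
    (Y * F - F * Y) - (X * G - G * X) + (F * G - G * F).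
  move=> XY; rewrite !mulrBl !mulrBr XY; set a := Y * X.
  move: (X * G) (F * Y) (F * G) (Y * F) (G * X) (G * F) => u v w x y z.
  rewrite !(opprB, addrA) [LHS](ACl (1*8*7*4*5*2*3*6)) /=.
  by rewrite subrr add0r.
rewrite bracketBB; last by case: b c => -[]; rewrite ?mulr0n ?mulr1n ?mulr0 ?mul0r.
rewrite [RHS]raddfD !(raddfB (@dop_series A)) /= !dop_seriesM; congr (_ - _ + _).
  case: c; rewrite ?mulr0n ?mulr1n ?mulr0 ?mul0r ?subrr ?raddf0//.
  by rewrite dz_commute addrAC subrr add0r.
case: b; rewrite ?mulr0n ?mulr1n ?mulr0 ?mul0r ?subrr ?raddf0//.
by rewrite dz_commute addrAC subrr add0r.
Qed.

(** Exchanging the rows [i] and [k] swaps the derivatives coming from [dz] with those coming from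
    the commutator of [L], so their sum is unchanged. *)
Lemma manin_lax (L : 'M[laurent A]_n) :
    (forall i j k l, L i j * L k l - L k l * L i j =
       lderiv (L k j) *+ (l == i) - lderiv (L i l) *+ (j == k)) ->
  manin (dz%:M - map_mx ser L).
Proof.
move=> LL i j k l; rewrite !mxE !dz_series_commutator !LL; congr ser.
by rewrite addrC [l == i]eq_sym [j == k]eq_sym [k == l]eq_sym [i == j]eq_sym.
Qed.

End LaxCommutator.

(** * Commutation relations between the entries of $L(z)$ *)

Lemma fsum_open_interval (V : zmodType) (q : nat) (v : V) :
  \sum_(a \in [set: int]) (if Negz q < a < 0 then v else 0) = v *+ q.
Proof.
elim: q => [|q IH]; first by rewrite mulr0n fsbig1// => a _; case: ifP => //; lia.
(* [Negz q] is $-(q+1)$, the one integer that the interval gains when [q] becomes [q.+1]. *)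
have delta_sum : \sum_(a \in [set: int]) (if a == Negz q then v else 0) = v.
  by rewrite (fsum_delta (k := Negz q)) ?eqxx// => a /negPf ->.
rewrite mulrSr -IH -[X in _ + X]delta_sum -(fsumD (W := q.+1)).
- apply: eq_fsbigr => /= a _.
  have : (Negz q.+1 < a < 0) = (Negz q < a < 0) || (a == Negz q) by lia.
  have : ~~ ((Negz q < a < 0) && (a == Negz q)) by lia.
  by case: (_ < _ < _) (a == _) => -[] // _ ->; rewrite ?addr0 ?add0r.
- by move=> a aq; case: ifP => //; lia.
- by move=> a aq; case: eqP => //; lia.
Qed.

Lemma mulrz_bool (V : zmodType) (x : V) (b : bool) (k : int) :
  x *+ b *~ k = x *~ k *+ b.
Proof. by case: b; rewrite // mul0rz. Qed.

(** For negative $m$, the $-(m+1)$ exponents strictly between $m$ and 0 contribute [v] each; this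
    count becomes the factor produced by differentiation. *)
Lemma lcoef_commutator (A : nzRingType) (f g : laurent A) (m : int) (v : A) :
    (forall a, 0 <= a -> f a = 0) -> (forall a, 0 <= a -> g a = 0) ->
    (0 <= m -> v = 0) ->
    (forall a, m < a < 0 -> f a * g (m - a) - g (m - a) * f a = v) ->
  (f * g - g * f) m = v *~ - (m + 1).
Proof.
move=> f0 g0 v0 fgv; pose G a := g (m - a) * f a.
have FG a : f a * g (m - a) = G a + (if m < a < 0 then v else 0).
  case: ifP => ma; first by rewrite -(fgv a ma) /G [RHS]addrC subrK.
  have [a0|a0] := lerP 0 a; first by rewrite /G f0// mul0r mulr0 addr0.
  by rewrite /G g0 ?mul0r ?mulr0 ?addr0//; lia.
have fs : \sum_(a \in [set: int]) (if m < a < 0 then v else 0) = v *~ - (m + 1).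
  (* For $m \ge 0$ the interval is empty but the multiplicity is nonzero, so [v] has to vanish. *)
  case: (m) v0 {G FG fgv} => [m' v0|q _].
    rewrite fsbig1 => [|a _]; last by case: ifP => //; lia.
    by rewrite v0 ?mul0rz//; lia.
  by rewrite fsum_open_interval (_ : - _ = q%:Z) ?pmulrn//; lia.
transitivity (\sum_(a \in [set: int]) (G a + (if m < a < 0 then v else 0))
    - \sum_(a \in [set: int]) G a).
  rewrite [LHS]lcoefD lcoefN !lcoefM.
  rewrite [X in _ - X](fsum_rev m).
  congr (_ - _); apply: eq_fsbigr => a _; first exact: FG.
  by rewrite /G (_ : m - (m - a) = a)//; lia.
rewrite (fsumD (W := `|m|%N)).
- by rewrite fs addrAC subrr add0r.
- move=> a am; have [a0|a0] := lerP 0 a; first by rewrite /G f0 ?mulr0.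
  by rewrite /G g0 ?mul0r//; lia.
- by move=> a am; case: ifP => //; lia.
Qed.

Section LglManin.
Variables (K : fieldType) (n : nat).

Lemma gl_elt_lie (i j k l : 'I_n) p q :
  lie (gl_elt K i j p) (gl_elt K k l q) =
  gl_elt K i l (p + q) *+ (j == k) - gl_elt K k j (p + q) *+ (l == i).
Proof.
have mulE a b c d r s : (gl_elt K a b r : 'M_n) *m gl_elt K c d s =
    gl_elt K a d (r + s) *+ (b == c).
  rewrite /gl_elt -scalemxAl -scalemxAr scalerA -exprD mul_delta_mx_cond.
  by case: eqP => _; rewrite ?scaler0.
by rewrite -[LHS]/((gl_elt K i j p : 'M_n) *m _ - _ *m _) !mulE [(q + p)%N]addnC.
Qed.

Lemma uea_gl_elt_commutator (i j k l : 'I_n) p q :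
  uea_inj (gl_elt K i j p) * uea_inj (gl_elt K k l q)
    - uea_inj (gl_elt K k l q) * uea_inj (gl_elt K i j p) =
  uea_inj (gl_elt K i l (p + q)) *+ (j == k)
    - uea_inj (gl_elt K k j (p + q)) *+ (l == i) :> Ugl K n.
Proof.
rewrite -uea_inj_lie gl_elt_lie.
rewrite (raddfB (@uea_inj K (gl_current K n))).
by rewrite !(raddfMn (@uea_inj K (gl_current K n))).
Qed.

(** The bracket of $e_{ij}t^p$ and $e_{kl}t^q$ depends on $p$ and $q$ only through $p+q$, so all
    splittings of the exponent $m$ contribute the same [v]. *)
Lemma Lgl_commutator (i j k l : 'I_n) :
  Lgl K n i j * Lgl K n k l - Lgl K n k l * Lgl K n i j =
  lderiv (Lgl K n k j) *+ (l == i) - lderiv (Lgl K n i l) *+ (j == k).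
Proof.
have coefE a b m : Lgl K n a b m =
    if m is Negz p then uea_inj (gl_elt K a b p) else 0 by rewrite mxE.
have neg_supp a b (m : int) : 0 <= m -> Lgl K n a b m = 0 by rewrite coefE; case: m.
apply/laurentP => m.
pose v := Lgl K n i l (m + 1) *+ (j == k) - Lgl K n k j (m + 1) *+ (l == i).
rewrite (lcoef_commutator (v := v)).
- by rewrite [RHS]lcoefD lcoefN !lcoefMb /= mulrNz mulrzBl opprB !mulrz_bool.
- exact: neg_supp.
- exact: neg_supp.
- by move=> m0; rewrite /v !neg_supp ?mul0rn ?subrr//; lia.
move=> a ma.
have [p ap] : exists p, a = Negz p by exists (`|a|.-1)%N; lia.
have [q aq] : exists q, m - a = Negz q by exists (`|(m - a)%R|.-1)%N; lia.
(* The exponents $-(p+1)$ and $-(q+1)$ add up to $m$, so $t^{p+q}$ sits at $z^{m+1}$, which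
   differentiation moves to $z^m$. *)
have m1 : m + 1 = Negz (p + q) by lia.
by rewrite /v m1 aq ap !coefE uea_gl_elt_commutator.
Qed.

Lemma Lgl_manin : manin ((dz (Ugl K n))%:M - map_mx (@dop_series _) (Lgl K n)).
Proof. exact/manin_lax/Lgl_commutator. Qed.

End LglManin.

(** * Passing between determinant coefficients and traces inside a subalgebra *)

Section SubalgebraCoefficients.
Variables (K : fieldType) (A : algType K) (B : {pred A}).
Hypothesis B_subalg : GRing.subalg_closed B.
Implicit Types (f g : laurent A).

Definition lcoef_in f := forall m, f m \in B.

Let B1 : 1 \in B. Proof. by case: B_subalg. Qed.
Let BZD (a : K) x y : x \in B -> y \in B -> a *: x + y \in B.
Proof. by case: B_subalg => _ BZD _; apply: BZD. Qed.
Let BM x y : x \in B -> y \in B -> x * y \in B.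
Proof. by case: B_subalg => _ _; apply. Qed.
Let B0 : 0 \in B.
Proof. by rewrite -(addNr 1) -scaleN1r BZD. Qed.
Let BD x y : x \in B -> y \in B -> x + y \in B.
Proof. by move=> Bx By; rewrite -[x]scale1r BZD. Qed.
Let BZ (a : K) x : x \in B -> a *: x \in B.
Proof. by move=> Bx; rewrite -[_ *: _]addr0 BZD. Qed.
Let BMz x (k : int) : x \in B -> x *~ k \in B.
Proof. by move=> Bx; rewrite -scaler_int BZ. Qed.

Lemma lcoef_in0 : lcoef_in 0. Proof. by move=> m. Qed.

Lemma lcoef_inD f g : lcoef_in f -> lcoef_in g -> lcoef_in (f + g).
Proof. by move=> Bf Bg m; apply: BD. Qed.

Lemma lcoef_inN f : lcoef_in f -> lcoef_in (- f).
Proof. by move=> Bf m; rewrite lcoefN -scaleN1r BZ. Qed.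

Lemma lcoef_in_addr f g x :
  f + g = x -> lcoef_in x -> lcoef_in g -> lcoef_in f.
Proof. by move=> <- Bfg Bg; rewrite -(addrK g f); apply/lcoef_inD/lcoef_inN. Qed.

Lemma lcoef_in_sum I (r : seq I) (p : pred I) (F : I -> laurent A) :
  (forall i, p i -> lcoef_in (F i)) -> lcoef_in (\sum_(i <- r | p i) F i).
Proof. by move=> BF; elim/big_ind: _ => //; exact: lcoef_inD. Qed.

Lemma lcoef_inMn f k : lcoef_in f -> lcoef_in (f *+ k).
Proof.
move=> Bf; elim: k => [|k IH]; first exact: lcoef_in0.
by rewrite mulrS; apply: lcoef_inD.
Qed.

Lemma lcoef_in_nat k : lcoef_in k%:R.
Proof. by apply: lcoef_inMn => m /=; case: ifP. Qed.

Lemma lcoef_inM f g : lcoef_in f -> lcoef_in g -> lcoef_in (f * g).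
Proof.
move=> Bf Bg m; rewrite lcoefM; have [V /(_ V (leqnn V)) fgV] := lmul_supp f g m.
by rewrite (fsum_box fgV); elim/big_ind: _ => // i _; apply: BM.
Qed.

Lemma lcoef_in_deriv f : lcoef_in f -> lcoef_in (lderiv f).
Proof. by move=> Bf m; apply: BMz. Qed.

Lemma lcoefMn f k m : (f *+ k) m = f m *+ k.
Proof. by elim: k => // k IH; rewrite !mulrS lcoefD IH. Qed.

Lemma lcoef_in_divn f k : (k%:R : K) != 0 -> lcoef_in (f *+ k) -> lcoef_in f.
Proof.
move=> k0 Bf m; rewrite -[f m](scalerK k0) scaler_nat -lcoefMn.
exact: BZ.
Qed.

Lemma lcoef_in_dzXM f k i : lcoef_in f ->
  lcoef_in (dop_coef (dz A ^+ k * dop_series f) i).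
Proof.
move=> Bf; elim: k i => [|k IH] i.
  by rewrite expr0 mul1r dop_coef_series; case: ifP => // _; exact: lcoef_in0.
rewrite exprS -mulrA dop_coef_dzM; apply: lcoef_inD; last exact: lcoef_in_deriv.
by case: i => [|i]; [exact: lcoef_in0|exact: IH].
Qed.

Variables (n : nat) (L : 'M[laurent A]_n).
Hypothesis charK : [pchar K] =i pred0.
Hypothesis L_manin : manin ((dz A)%:M - map_mx (@dop_series A) L).
Local Notation h k := (dop_coef (QH_operator L) k).
Local Notation tau k := (\tr (qpow L k)).

Let natK_neq0 k : (0 < k)%N -> (k%:R : K) != 0.
Proof. by move/pcharf0P: charK => ->; rewrite -lt0n. Qed.

Let reg2 (x : A) : x *+ 2 = 0 -> x = 0.
Proof.
move=> x2; rewrite -[x](scalerK (natK_neq0 (isT : (0 < 2)%N))) scaler_nat x2.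
exact: scaler0.
Qed.

Let Newton := quantum_Newton reg2 L_manin.
Let CayleyHamilton := quantum_Cayley_Hamilton reg2 L_manin.

Lemma tau0 : tau 0 = n%:R.
Proof. by rewrite mxtrace1. Qed.

Section TracesFromCoefficients.
Hypothesis Bh : forall k, (k <= n)%N -> lcoef_in (h k).

(** Strong induction: in the Newton identity of order $n-1-p$, [tau p] enters only through [k = n]
    and [i = p], with factor [h n = 1]; the other surviving traces have smaller index. *)
Lemma lcoef_in_tau_lt p : (p < n)%N -> lcoef_in (tau p).
Proof.
elim/ltn_ind: p => p IH pn.
have mn : (n.-1 - p < n)%N by lia.
have Bterm k i : (k <= n)%N -> (i < k)%N -> (k < n)%N || (i != p) ->
    lcoef_in (dop_coef (dz A ^+ (k.-1 - i) * dop_series (tau i)) (n.-1 - p)).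
  move=> kn ik kip; have [ip|pi] := ltnP i p.
    by apply: lcoef_in_dzXM; apply: IH => //; lia.
  by rewrite dop_coef_dzXM_gt; [exact: lcoef_in0|lia].
have := Newton mn; rewrite big_ord_recr /= QH_operator_lead mul1r addrC.
rewrite (bigD1 (Ordinal pn))//= dop_coef_dzXM -addrA => e.
apply: (lcoef_in_addr e); first exact/lcoef_inMn/Bh.
apply: lcoef_inD.
  by apply: lcoef_in_sum => i ip; apply: Bterm => //; rewrite ip orbT.
apply: lcoef_in_sum => k _; apply: lcoef_inM; first by apply: Bh; apply: ltnW.
by apply: lcoef_in_sum => i _; apply: Bterm; rewrite ?ltn_ord// ltnW.
Qed.

(* Iterating [X |-> X L + X'] on the Cayley-Hamilton relation reduces every
   quantum power to the first [n] ones. *)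
Lemma qpow_reduction j : (0 < n)%N -> exists2 g : nat -> laurent A,
  forall k, (k < n)%N -> lcoef_in (g k) & qpow L j = \sum_(k < n) g k *: qpow L k.
Proof.
move=> n0; elim: j => [|j [g Bg gE]].
  exists (fun k => (k == 0%N)%:R) => [k _|]; first exact: lcoef_in_nat.
  rewrite (bigD1 (Ordinal n0))// big1 => [|k k0]; first by rewrite /= addr0 scale1r.
  by rewrite -val_eqE /= in k0; rewrite (negPf k0) scale0r.
(* Replacing [qpow L k] by [qpow L k.+1] shifts the coefficients; the overflow [g1 n] at [qpow L n]
   is removed by Cayley-Hamilton, where [h n = 1]. *)
pose g1 k := if k is k'.+1 then g k' else 0.
have Bg1 k : (k <= n)%N -> lcoef_in (g1 k).
  by case: k => [|k] kn; [exact: lcoef_in0|exact: Bg].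
have shiftE : \sum_(k < n) g k *: qpow L k.+1
    = \sum_(k < n) g1 k *: qpow L k + g1 n *: qpow L n.
  have := big_ord_recr n (fun k => g1 k *: qpow L k) => /= <-.
  by rewrite big_ord_recl /= scale0r add0r.
have qpow_n : qpow L n = - \sum_(k < n) h k *: qpow L k.
  apply/eqP; rewrite -addr_eq0 addrC -[qpow L n]scale1r -(QH_operator_lead L).
  by rewrite -(big_ord_recr n (fun k => h k *: qpow L k)) CayleyHamilton.
(* The three terms come from the product rule, the shift and the substitution for [qpow L n]. *)
exists (fun k => lderiv (g k) + (g1 k - g1 n * h k)) => [k kn|].
  apply: lcoef_inD; first exact/lcoef_in_deriv/Bg.
  apply: lcoef_inD; first exact/Bg1/ltnW.
  by apply/lcoef_inN/lcoef_inM; [exact: Bg1|exact/Bh/ltnW].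
transitivity (\sum_(k < n) (lderiv (g k) *: qpow L k + g k *: qpow L k.+1)).
  rewrite /= gE mulmx_suml raddf_sum -big_split /=.
  apply: eq_bigr => k _; rewrite scalerDr -scalemxAl addrCA; congr (_ + _).
  by apply/matrixP => a b; rewrite !mxE /= lderivM.
rewrite big_split /= shiftE qpow_n scalerN scaler_sumr -sumrB -big_split /=.
by apply: eq_bigr => k _; rewrite scalerDl scalerBl scalerA.
Qed.

Lemma lcoef_in_tau j : (0 < n)%N -> lcoef_in (tau j).
Proof.
move=> n0; have [g Bg ->] := qpow_reduction j n0.
rewrite raddf_sum; apply: lcoef_in_sum => k _; rewrite /= mxtraceZ.
by apply: lcoef_inM; [exact: Bg|exact: lcoef_in_tau_lt].
Qed.

End TracesFromCoefficients.

(** Descending induction from [h n = 1]. As [tau 0] is $n$, the Newton identity of order $m$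
    determines $n-(m+1)$ times [h m.+1] from the higher coefficients, and this integer is invertible
    in characteristic zero. *)
Lemma lcoef_in_QH : (forall k, (1 <= k <= n)%N -> lcoef_in (tau k)) ->
  forall k, (k <= n)%N -> lcoef_in (h k).
Proof.
move=> Btau' k kn; rewrite -(subKn kn); move: (n - k)%N (leq_subr k n) => p {k kn}.
have Btau k : (k <= n)%N -> lcoef_in (tau k).
  by case: k => [|k] kn; [rewrite tau0; exact: lcoef_in_nat|exact: Btau'].
elim/ltn_ind: p => -[|p] IH pn.
  by rewrite subn0 QH_operator_lead; exact: (lcoef_in_nat 1).
have IHk k : (n - p.+1 < k)%N -> (k <= n)%N -> lcoef_in (h k).
  by move=> pk kn; rewrite -(subKn kn); apply: IH; lia.
apply: (lcoef_in_divn (natK_neq0 (ltn0Sn p))).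
have [[m mE]|m0] : {m | (n - p.+1)%N = m.+1} + {(n - p.+1)%N = 0%N}.
- by case: (n - p.+1)%N => [|m]; [right|left; exists m].
- rewrite mE; have mn : (m < n)%N by lia.
  have mn1 : (m.+1 < n.+1)%N by [].
  have := Newton mn; rewrite (bigD1 (Ordinal mn1))//= big_ord_recl /= subn0.
  rewrite dop_coef_dzXM tau0 big1 => [|i _]; last first.
    by rewrite dop_coef_dzXM_gt ?raddf0// /bump /=; have := ltn_ord i; lia.
  rewrite addr0 mulr_natr.
  have -> : h m.+1 *+ n = h m.+1 *+ m.+1 + h m.+1 *+ p.+1.
    by rewrite -mulrnDr; congr (_ *+ _); lia.
  rewrite -addrA -[RHS]addr0 => /addrI e.
  apply: (lcoef_in_addr e); first exact: lcoef_in0.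
  apply: lcoef_in_sum => k; rewrite -val_eqE /= => km.
  have [mk|km1] := ltnP m.+1 k.
    apply: lcoef_inM; first by apply: IHk; [|rewrite -ltnS]; [lia|exact: ltn_ord].
    apply: lcoef_in_sum => i _; apply: lcoef_in_dzXM; apply: Btau.
    by have := ltn_ord i; have := ltn_ord k; lia.
  rewrite big1 ?mulr0; first exact: lcoef_in0.
  by move=> i _; rewrite dop_coef_dzXM_gt//; have := ltn_ord i; lia.
(* The Newton identities stop at [h 1]; [h 0] comes from the trace of the Cayley-Hamilton relation,
   where its factor is [tau 0], that is $n$. *)
have pE : p.+1 = n by lia.
rewrite m0 pE; have /(congr1 (@mxtrace _ _)) := CayleyHamilton.
rewrite raddf_sum mxtrace0 big_ord_recl /= mxtraceZ tau0 mulr_natr => e.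
apply: (lcoef_in_addr e); first exact: lcoef_in0.
apply: lcoef_in_sum => k _; rewrite mxtraceZ; apply: lcoef_inM.
  by apply: IHk; rewrite ?m0 /bump.
exact: (Btau k.+1 (ltn_ord k)).
Qed.

End SubalgebraCoefficients.

(** * Generation of the Bethe subalgebra over the complex numbers *)

Local Open Scope complex_scope.
Local Open Scope classical_set_scope.

Theorem corollary1 (R : realType) (n : nat) (hn : (0 < n)%N) :
  (forall (k : nat) (m : int),
     bethe R[i] n (lcoef (\tr (qpow (Lgl R[i] n) k)) m)) /\
  subalg_gen [set x : Ugl R[i] n | exists (k : nat) (m : int),
     (1 <= k <= n)%N /\ x = lcoef (\tr (qpow (Lgl R[i] n) k)) m]
  = bethe R[i] n.
Proof.
have charC := pchar_num R[i].
have manL := @Lgl_manin R[i] n.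
(* Membership in a generated subalgebra quantifies over all subalgebras [B], so each claim says that
   a [B] holding the coefficients of one family holds those of the other. *)
split=> [k m B Bsub BQH|].
  apply: (lcoef_in_tau Bsub charC manL) hn _ => i ile m'.
  by apply: BQH; exists i, m'.
apply/seteqP; split=> x Bx B Bsub BX; apply: Bx => // y [k [m [kn ->]]].
  apply: (lcoef_in_tau Bsub charC manL) hn _ => i ile m'.
  by apply: BX; exists i, m'.
apply: (lcoef_in_QH Bsub charC manL) kn _ => i ile m'.
by apply: BX; exists i, m'.
Qed.
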